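(* Let $(\mathcal Q,d)$ be a Hadamard space, write $\overline{qp}:=d(q,p)$, let $Y$ be a $\mathcal Q$-valued random variable and $Y_1,\dots,Y_n$ independent copies of $Y$. Assume: (i) Existence: Let $a\in[\frac12,1]$ and let $o\in\mathcal Q$ be an arbitrary fixed point. There are a measurable $m_n\in\arg\min_{q\in\mathcal Q}\frac1n\sum_{i=1}^n\big(\overline{Y_iq}^{2a}-\overline{Y_io}^{2a}\big)$ and an $m\in\arg\min_{q\in\mathcal Q}\mathbb E\big[\overline{Yq}^{2a}-\overline{Yo}^{2a}\big]$. (ii) Growth: There are constants $c_{\mathsf g}>0$, $\gamma\in(1,\infty)$ such that $\mathbb E\big[\overline{Yq}^{2a}-\overline{Ym}^{2a}\big]\ge c_{\mathsf g}\,d(m,q)^\gamma$ for all $q\in\mathcal Q$. (iii) Moment: $\mathbb E\big[\overline{Yq}^{2(2a-1)}\big]<\infty$ for one (and thus for all) $q\in\mathcal Q$. (iv) Entropy: There are $\beta>0$, $c_{\mathsf e}>0$ such that $\sqrt{\log N(\mathrm B_\delta(m,d),d,r)}\le c_{\mathsf e}\big(\frac\delta r\big)^\beta$ for all $\delta,r>0$. Then for all $s>0$ $$\mathbb P\Big(\eta_{\beta,n}^{-\frac1{\gamma-1}}\,\overline{m\,m_n}\ge s\Big)\le c\,\mathbb E\big[\overline{Yo}^{2(2a-1)}\big]\,s^{-2(\gamma-1)},$$ where $c>0$ depends only on $\beta,\gamma,c_{\mathsf e},c_{\mathsf g}$. In particular, $d(m,m_n)=O_{\mathbb P}\big(\eta_{\beta,n}^{\frac1{\gamma-1}}\big)$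 as $n\to\infty$.
   Context: A Hadamard space is a complete CAT(0) space, equivalently a nonempty complete metric space such that for all $y_1,y_2\in\mathcal Q$ there is $m\in\mathcal Q$ with $d(m,q)^2\le\frac12d(y_1,q)^2+\frac12d(y_2,q)^2-\frac14d(y_1,y_2)^2$ for all $q\in\mathcal Q$. $\eta_{\beta,n}:=n^{-1/2}$ if $\beta<1$, $\eta_{\beta,n}:=n^{-1/2}\log(n+1)$ if $\beta=1$, $\eta_{\beta,n}:=n^{-\frac1{2\beta}}$ if $\beta>1$. $\mathrm B_r(o,d):=\{q\in\mathcal Q:d(o,q)\le r\}$; for $A\subseteq\mathcal Q$, $N(A,d,r)$ is the minimal number of balls $\mathrm B_r(q_j,d)$, $q_j\in\mathcal Q$, covering $A$. Convention: $0^0=1$. *)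

(* Defs.v *)
From HB Require Import structures.
From mathcomp Require Import all_boot all_order all_algebra.
From mathcomp Require Import finmap.
From mathcomp Require Import all_classical all_reals all_analysis.

Set Implicit Arguments.
Unset Strict Implicit.
Unset Printing Implicit Defensive.

Import Order.TTheory GRing.Theory Num.Theory.
Import numFieldNormedType.Exports.

Local Open Scope classical_set_scope.
Local Open Scope ring_scope.

(* [Complete] carries a point, so these spaces are nonempty. *)
#[short(type="completeMetricType")]
HB.structure Definition CompleteMetric (R : numDomainType) :=
  { Q of Metric R Q & Complete Q }.

Definition hadamard_space (R : realType) (Q : completeMetricType R) : Prop :=
  forall y1 y2 : Q, exists m : Q, forall q : Q,
    mdist m q ^+ 2 <= 2^-1 * mdist y1 q ^+ 2 + 2^-1 * mdist y2 q ^+ 2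
                      - 4^-1 * mdist y1 y2 ^+ 2.

(* The space Q equipped with its Borel sigma-algebra. *)
Notation borel Q := (g_sigma_algebraType (@open Q)).

Definition cball (R : realType) (Q : completeMetricType R) (o : Q) (r : R) :
    set Q :=
  [set q | mdist o q <= r].

(* An infimum over a set of naturals, hence a minimum; it is +oo when no finite
   cover exists. *)
Definition covering_number (R : realType) (Q : completeMetricType R)
    (A : set Q) (r : R) : \bar R :=
  ereal_inf [set (size s)%:R%:E |
    s in [set s : seq Q | A `<=` \bigcup_(q in [set` s]) cball q r]].

Definition argmin (T : Type) (disp : Order.disp_t) (U : porderType disp)
    (f : T -> U) : set T :=
  [set x | forall q, (f x <= f q)%O].

(* The library's powR satisfies 0 `^ 0 = 1. *)
Definition empirical_objective (R : realType) (Q : completeMetricType R)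
    (a : R) (o : Q) (n : nat) (y : 'I_n -> Q) (q : Q) : R :=
  n%:R^-1 * \sum_(i < n) (mdist (y i) q `^ (2 * a) - mdist (y i) o `^ (2 * a)).

Section probability.
Context (R : realType) (d : measure_display) (T : measurableType d)
        (P : probability T R).

Definition objective (Q : completeMetricType R) (Y : {RV P >-> borel Q})
    (a : R) (o q : Q) : \bar R :=
  'E_P[fun w => mdist (Y w : Q) q `^ (2 * a) - mdist (Y w : Q) o `^ (2 * a)].

Definition moment (Q : completeMetricType R) (Y : {RV P >-> borel Q})
    (a : R) (q : Q) : \bar R :=
  'E_P[fun w => mdist (Y w : Q) q `^ (2 * (2 * a - 1))].

Definition mutually_independent (d' : measure_display) (S : measurableType d')
    (I : choiceType) (X : I -> {RV P >-> S}) : Prop :=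
  forall (J : {fset I}) (A : I -> set S),
    (forall i, measurable (A i)) ->
    P (\bigcap_(i in [set` J]) (X i @^-1` A i))
    = (\prod_(i <- J) P (X i @^-1` A i))%E.

(* The independence is that of the copies among themselves. *)
Definition independent_copies (d' : measure_display) (S : measurableType d')
    (Y : {RV P >-> S}) (I : choiceType) (X : I -> {RV P >-> S}) : Prop :=
  mutually_independent X /\
  forall (i : I) (A : set S), measurable A ->
    distribution P (X i) A = distribution P Y A.

(* X n = O_P(r n) as n tends to infinity. *)
Definition bigO_in_probability (X : nat -> T -> R) (r : nat -> R) : Prop :=
  forall e : R, 0 < e -> exists M : R, 0 < M /\
    \forall n \near \oo, (P [set w | (M * r n < `|X n w|)%R] <= e%:E)%E.

End probability.

Definition entropy_rate (R : realType) (beta : R) (n : nat) : R :=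
  if beta < 1 then n%:R `^ (- 2^-1)
  else if beta == 1 then n%:R `^ (- 2^-1) * ln (n.+1)%:R
  else n%:R `^ (- (2 * beta)^-1).

(* Main.v *)
Require Import Defs.
From HB Require Import structures.
From mathcomp Require Import all_boot all_order all_algebra.
From mathcomp Require Import finmap.
From mathcomp Require Import all_classical all_reals all_analysis.
From mathcomp Require Import measurable_realfun ring lra.

Set Implicit Arguments.
Unset Strict Implicit.
Unset Printing Implicit Defensive.

Import Order.TTheory GRing.Theory Num.Theory.
Import numFieldNormedType.Exports.

Local Open Scope classical_set_scope.
Local Open Scope ring_scope.


(** Write F(q) = E[d(Y,q)^(2a) - d(Y,m)^(2a)] and let Fn be its empirical
    counterpart.  The growth condition and the minimality of m_n give
    cg d(m,m_n)^gamma <= F(m_n) <= F(m_n) - Fn(m_n), so everything rests on the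
    size of the centred process F - Fn on balls around m
    ([basic_inequality]).

    The increments of that process are controlled by the quadruple inequality
    |d(y,q)^(2a) - d(y,p)^(2a) - d(z,q)^(2a) + d(z,p)^(2a)|
      <= C d(q,p) d(y,z)^(2a-1)    ([quadruple_pow]).
    With z = o it says that, up to terms that centring cancels, the increment
    between p and q is bounded by d(p,q) times the envelope d(y,o)^(2a-1), whose
    square has the expectation that appears in the theorem.  For a = 1 the
    quadruple inequality comes from the midpoint inequality (with a worse
    constant than Reshetnyak's 2); for a = 1/2 it is the triangle inequality;
    the powers in between follow from the case a = 1
    by calculus on four real numbers.

    The second moment of the supremum over a ball of radius delta is then
    bounded by chaining ([chaining]).  The chain stops at radius delta / 2^K
    and the remainder is estimated by the envelope alone: this is what makes
    entropy exponents beta >= 1 possible, and optimising K produces the three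
    regimes of the rate ([chaining_rate]).  Each link is a maximum over finitely
    many independent sums, bounded by a maximal inequality that loses only a
    logarithm of the number of sums although the envelope has just two moments
    ([indep_maximal_inequality]).  It is obtained by symmetrization followed by
    exponential moments of Rademacher sums.

    Finally Markov's inequality on the dyadic shells 2^j s <= d(m,m_n) <=
    2^(j+1) s gives a geometric series, because delta^2 against
    delta^(2 gamma) decays for gamma > 1 ([peeling]). *)

(** * The quadruple inequality *)

Section real_lemmas.
Variable R : realType.
Implicit Types x y : R.

Lemma dyadic_floor x : 1 <= x -> exists k : nat, 2 ^+ k <= x < 2 ^+ k.+1.
Proof.
move=> x1; have x0 : 0 <= x by lra.
have /andP[tx xt] := truncn_itv x0.
have t0 : (0 < Num.truncn x)%N by rewrite truncn_gt0.
have /andP[lo hi] := trunc_log_bounds (ltnSn 1) t0.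
exists (trunc_log 2 (Num.truncn x)); apply/andP; split.
  by apply: le_trans tx; rewrite -natrX ler_nat.
by apply: lt_le_trans xt _; rewrite -natrX ler_nat.
Qed.

(** The tangent to the convex function t^al at x lies below its graph; this is
    Young's inequality for y and x^(al-1). *)
Lemma powR_tangent (al : R) x y : 1 <= al -> 0 <= x -> 0 <= y ->
  x `^ al - y `^ al <= al * x `^ (al - 1) * (x - y).
Proof.
move=> al1 x0 y0; have al0 : 0 < al by lra.
have [->|aln1] := eqVneq al 1; first by rewrite !powRr1// subrr powRr0; lra.
have alm1 : 0 < al - 1 by rewrite subr_gt0 lt_neqAle eq_sym aln1.
have := @conjugate_powR R y (x `^ (al - 1)) al (al / (al - 1)) y0 (powR_ge0 _ _) al0.
rewrite divr_gt0// => /(_ isT).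
have -> : al^-1 + (al / (al - 1))^-1 = 1 by field; rewrite !gt_eqF.
move=> /(_ erefl).
rewrite -powRrM (_ : (al - 1) * _ = al); last by field; rewrite gt_eqF.
rewrite invf_div => young.
rewrite mulrBr -mulrA [x `^ _ * x]mulrC mulr_powRB1//.
suff : al * (y * x `^ (al - 1)) <= y `^ al + x `^ al * (al - 1) by lra.
rewrite -(ler_pM2l al0) in young; apply: le_trans young _.
by rewrite le_eqVlt; apply/orP; left; apply/eqP; field; rewrite gt_eqF.
Qed.

Lemma powR_subadd (th : R) x y : 0 <= th <= 1 -> 0 <= x -> 0 <= y ->
  (x + y) `^ th <= x `^ th + y `^ th.
Proof.
move=> /andP[th0 th1] x0 y0.
have [s0|sn0] := eqVneq (x + y) 0.
  have -> : x = 0 by lra.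
  have -> : y = 0 by lra.
  by rewrite addr0; have := powR_ge0 (0 : R) th; lra.
have s0 : 0 < x + y by rewrite lt_neqAle eq_sym sn0 addr_ge0.
have frac z : 0 <= z -> z <= x + y -> z / (x + y) * (x + y) `^ th <= z `^ th.
  move=> z0 zs; have [->|zn0] := eqVneq z 0; first by rewrite mul0r mul0r powR_ge0.
  have {}z0 : 0 < z by rewrite lt_neqAle eq_sym zn0.
  rewrite -[X in _ <= X `^ _](divfK sn0 z) powRM; [|by rewrite divr_ge0// ltW|exact: ltW].
  rewrite ler_wpM2r ?powR_ge0// ger1_powR//.
  by rewrite divr_gt0//= ler_pdivrMr// mul1r.
have := frac x x0; have := frac y y0.
move=> /(_ ltac:(lra)) h1 /(_ ltac:(lra)) h2; apply: le_trans (lerD h2 h1).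
by rewrite -mulrDl -mulrDl divff// mul1r.
Qed.

Lemma powR_dist_le (th : R) x y : 0 <= th <= 1 -> 0 <= x -> 0 <= y ->
  `|x `^ th - y `^ th| <= `|x - y| `^ th.
Proof.
move=> th01 x0 y0; wlog xy : x y x0 y0 / y <= x => [hw|].
  by have [|/ltW] := leP y x; [|rewrite distrC (distrC x)]; exact: hw.
rewrite !ger0_norm ?subr_ge0//; last first.
  by rewrite ge0_ler_powR// ?nnegrE//; case/andP: th01.
rewrite lerBlDr; have := powR_subadd th01 (_ : 0 <= x - y) y0.
by rewrite subrK; apply; rewrite subr_ge0.
Qed.

(** Here A, B, C, D stand for the distances yq, yp, zq, zp, and e, h for qp, yz.
    Tangents at A and at D bound the left-hand side by al times
    D^(al-1) (A - B - C + D) + (A^(al-1) - D^(al-1)) (A - B).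
    The second term is at most (e+h)^(al-1) e, by subadditivity of the power
    al - 1 <= 1.  In the first one, A - B - C + D is at most 2e and, by the
    inequality on squares, at most 5eh/D; the former serves when D <= h, the
    latter when D > h, where D^(al-2) <= h^(al-2). *)
Lemma quadruple_powR_le (al A B C D e h : R) : 1 <= al <= 2 ->
  0 <= A -> 0 <= B -> 0 <= C -> 0 <= D -> 0 < e -> e <= h ->
  `|A - B| <= e -> `|C - D| <= e -> `|A - C| <= h -> `|B - D| <= h ->
  A ^+ 2 - B ^+ 2 - C ^+ 2 + D ^+ 2 <= 3 * e * h ->
  A `^ al - B `^ al - C `^ al + D `^ al <= 14 * e * h `^ (al - 1).
Proof.
move=> /andP[al1 al2] A0 B0 C0 D0 e0 eh AB CD AC BD sq.
have h0 : 0 < h by lra.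
have th01 : 0 <= al - 1 <= 1 by apply/andP; split; lra.
have T1 := powR_tangent al1 A0 B0; have T2 := powR_tangent al1 D0 C0.
have hp0 : 0 < h `^ (al - 1) by rewrite powR_gt0.
have Dp0 := powR_ge0 D (al - 1).
have AD : `|A `^ (al - 1) - D `^ (al - 1)| <= 2 * h `^ (al - 1).
  apply: le_trans (powR_dist_le th01 A0 D0) _.
  apply: (@le_trans _ _ ((h + h) `^ (al - 1))).
    rewrite ge0_ler_powR ?nnegrE//; [lra|lra|].
    by move: AB CD AC BD; rewrite !ler_norml; lra.
  by apply: le_trans (powR_subadd th01 (ltW h0) (ltW h0)) _; lra.
have P2 : (A `^ (al - 1) - D `^ (al - 1)) * (A - B) <= 2 * h `^ (al - 1) * e.
  apply: le_trans (ler_norm _) _; rewrite normrM.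
  by apply: ler_pM.
have P1 : D `^ (al - 1) * (A - B - C + D) <= 5 * e * h `^ (al - 1).
  have X2 : A - B - C + D <= 2 * e by move: AB CD; rewrite !ler_norml; lra.
  have [Dh|hD] := leP D h.
    have DH : D `^ (al - 1) <= h `^ (al - 1) by rewrite ge0_ler_powR ?nnegrE//; lra.
    have [X0|X0] := leP 0 (A - B - C + D); nra.
  have Dpos : 0 < D by lra.
  have XD : (A - B - C + D) * D <= 5 * e * h.
    have [X0|X0] := leP 0 (A - B - C + D); last by nra.
    have : (A - B - C + D) * (C + D) <= 5 * e * h.
      have : `|(A - B) * (A + B - C - D)| <= e * (2 * h).
        rewrite normrM; apply: ler_pM => //.
        by move: AC BD; rewrite !ler_norml; lra.
      by rewrite ler_norml; nra.
    by nra.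
  rewrite -(@ler_pM2r _ D)//.
  have -> : D `^ (al - 1) * (A - B - C + D) * D = D `^ (al - 1) * ((A - B - C + D) * D).
    by ring.
  apply: (@le_trans _ _ (D `^ (al - 1) * (5 * e * h))); first by rewrite ler_wpM2l.
  have : D `^ (al - 1) * h <= h `^ (al - 1) * D.
    have -> : D = h * (D / h) by field; lra.
    rewrite powRM; [|exact: ltW|by rewrite divr_ge0// ltW].
    rewrite mulrAC [leRHS]mulrA ler_wpM2l//.
      by rewrite mulr_ge0// ltW.
    rewrite ler1_powR//; last lra.
    by rewrite ler_pdivlMr// mul1r ltW.
  by nra.
have : al * (D `^ (al - 1) * (A - B - C + D) +
    (A `^ (al - 1) - D `^ (al - 1)) * (A - B)) <= 14 * e * h `^ (al - 1).
  apply: (@le_trans _ _ (al * (7 * e * h `^ (al - 1)))).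
    by rewrite ler_wpM2l; lra.
  have eh0 : 0 < e * h `^ (al - 1) by rewrite mulr_gt0.
  rewrite -!(mulrA _ e); nra.
by nra.
Qed.

(** Exchanging the roles of (y,z) and (q,p) reduces h < e to the case e <= h: it
    gives h e^(al-1), which is at most e h^(al-1) since al - 1 <= 1. *)
Lemma quadruple_powR (al A B C D e h : R) : 1 <= al <= 2 ->
  0 <= A -> 0 <= B -> 0 <= C -> 0 <= D -> 0 <= e -> 0 <= h ->
  `|A - B| <= e -> `|C - D| <= e -> `|A - C| <= h -> `|B - D| <= h ->
  A ^+ 2 - B ^+ 2 - C ^+ 2 + D ^+ 2 <= 3 * e * h ->
  A `^ al - B `^ al - C `^ al + D `^ al <= 14 * e * h `^ (al - 1).
Proof.
move=> al12 A0 B0 C0 D0 e0 h0 AB CD AC BD sq.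
have [e_0|en0] := eqVneq e 0.
  have -> : A = B by move: AB; rewrite e_0 normr_le0 subr_eq0 => /eqP.
  have -> : C = D by move: CD; rewrite e_0 normr_le0 subr_eq0 => /eqP.
  by rewrite e_0; lra.
have {en0}e0 : 0 < e by rewrite lt_neqAle eq_sym en0.
have [h_0|hn0] := eqVneq h 0.
  have -> : A = C by move: AC; rewrite h_0 normr_le0 subr_eq0 => /eqP.
  have -> : B = D by move: BD; rewrite h_0 normr_le0 subr_eq0 => /eqP.
  have : 0 <= 14 * e * h `^ (al - 1) by rewrite mulr_ge0 ?powR_ge0//; lra.
  by lra.
have {hn0}h0 : 0 < h by rewrite lt_neqAle eq_sym hn0.
have [eh|/ltW he] := leP e h; first exact: quadruple_powR_le sq.
have : A `^ al - C `^ al - B `^ al + D `^ al <= 14 * h * e `^ (al - 1).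
  by apply: quadruple_powR_le => //; lra.
have : h * e `^ (al - 1) <= e * h `^ (al - 1).
  have -> : e = h * (e / h) by field; rewrite gt_eqF.
  rewrite powRM; [|exact: ltW|by rewrite divr_ge0// ltW].
  rewrite mulrA [leRHS]mulrAC ler_wpM2l//.
    by rewrite mulr_ge0// ?powR_ge0// ltW.
  rewrite ler1_powR//; last by case/andP: al12; lra.
  by rewrite ler_pdivlMr// mul1r.
lra.
Qed.

End real_lemmas.

Section hadamard_geometry.
Variables (R : realType) (Q : completeMetricType R).
Hypothesis hQ : hadamard_space Q.
Implicit Types y z q p : Q.

Lemma dist_diff_le y q p : `|mdist y q - mdist y p| <= mdist q p.
Proof.
have := metric_triangle y p q; have := metric_triangle y q p.
by rewrite (metric_sym p q) ler_norml; lra.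
Qed.

(** In the quadrilateral y, z, q, p the sum of the squared diagonals yq and zp is
    at most the sum of the squared sides: compare z and p with the midpoint of
    the diagonal yq. *)
Lemma quadrilateral y z q p :
  mdist y q ^+ 2 - mdist y p ^+ 2 - mdist z q ^+ 2 + mdist z p ^+ 2
  <= mdist y z ^+ 2 + mdist q p ^+ 2.
Proof.
have [m hm] := hQ y q; have := hm z; have := hm p.
have tri := metric_triangle z m p.
rewrite (metric_sym q z) (metric_sym z m) in tri *.
have := mdist_ge0 m z; have := mdist_ge0 m p; have := mdist_ge0 z p.
move: (mdist m z) (mdist m p) (mdist z p) tri => u v w tri w0 v0 u0.
have : w ^+ 2 <= 2 * u ^+ 2 + 2 * v ^+ 2.
  apply: (@le_trans _ _ ((u + v) ^+ 2)); first by rewrite ler_pXn2r ?nnegrE//; lra.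
  by have := sqr_ge0 (u - v); rewrite sqrrB sqrrD; lra.
lra.
Qed.

(** The left-hand side is additive when the segment yz is cut at its midpoint,
    while the square yz^2 drops to a quarter; k bisections trade a factor 2^-k on
    yz^2 for a factor 2^k on qp^2. *)
Lemma quadruple_dyadic k y z q p :
  mdist y q ^+ 2 - mdist y p ^+ 2 - mdist z q ^+ 2 + mdist z p ^+ 2
  <= mdist y z ^+ 2 / 2 ^+ k + 2 ^+ k * mdist q p ^+ 2.
Proof.
elim: k y z => [|k IH] y z; first by rewrite expr0 divr1 mul1r quadrilateral.
have [m hm] := hQ y z.
have hy : mdist y m ^+ 2 <= mdist y z ^+ 2 / 4.
  by have := hm y; rewrite mdistxx (metric_sym z y) (metric_sym m y) expr0n/=; lra.
have hz : mdist m z ^+ 2 <= mdist y z ^+ 2 / 4.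
  by have := hm z; rewrite mdistxx expr0n/=; lra.
have := IH y m; have := IH m z.
have k0 : 0 < (2 : R) ^- k by rewrite invr_gt0 exprn_gt0.
rewrite !exprS invfM.
have := ler_wpM2r (ltW k0) hy; have := ler_wpM2r (ltW k0) hz.
lra.
Qed.

(** Choose k so that 2^k is the ratio yz/qp up to a factor 2. *)
Lemma quadruple_sq y z q p :
  mdist y q ^+ 2 - mdist y p ^+ 2 - mdist z q ^+ 2 + mdist z p ^+ 2
  <= 3 * mdist q p * mdist y z.
Proof.
have := mdist_ge0 q p; have := mdist_ge0 y z.
wlog qpyz : y z q p / mdist q p <= mdist y z => [hw|] yz0 qp0.
  have [le|/ltW le] := leP (mdist q p) (mdist y z); first exact: hw.
  have := hw q p y z le qp0 yz0.
  rewrite (metric_sym q y) (metric_sym q z) (metric_sym p y) (metric_sym p z); lra.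
have [q_p|qpn0] := eqVneq (mdist q p) 0.
  by rewrite (mdist_positivity q p q_p) mdistxx; lra.
have {}qp0 : 0 < mdist q p by rewrite lt_neqAle eq_sym qpn0.
have [|k /andP[lo hi]] := @dyadic_floor R (mdist y z / mdist q p).
  by rewrite ler_pdivlMr// mul1r.
rewrite ler_pdivlMr// in lo; rewrite ltr_pdivrMr// exprS in hi.
apply: le_trans (quadruple_dyadic k _ _ _ _) _.
have t0 : 0 < (2 : R) ^+ k by rewrite exprn_gt0.
have : mdist y z ^+ 2 / 2 ^+ k <= 2 * mdist q p * mdist y z.
  by rewrite ler_pdivrMr// expr2; nra.
by rewrite expr2; nra.
Qed.

Lemma quadruple_pow a y z q p : 2^-1 <= a <= 1 ->
  `|mdist y q `^ (2 * a) - mdist y p `^ (2 * a)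
    - mdist z q `^ (2 * a) + mdist z p `^ (2 * a)|
  <= 14 * mdist q p * mdist y z `^ (2 * a - 1).
Proof.
move=> a12; have al12 : 1 <= 2 * a <= 2 by apply/andP; split; lra.
have main q' p' : mdist y q' `^ (2 * a) - mdist y p' `^ (2 * a)
    - mdist z q' `^ (2 * a) + mdist z p' `^ (2 * a)
  <= 14 * mdist q' p' * mdist y z `^ (2 * a - 1).
  apply: quadruple_powR; rewrite ?mdist_ge0 ?dist_diff_le ?quadruple_sq//.
    by rewrite !(metric_sym _ q') dist_diff_le.
  by rewrite !(metric_sym _ p') dist_diff_le.
rewrite ler_norml main andbT lerNl.
by have := main p q; rewrite (metric_sym p q); lra.
Qed.

End hadamard_geometry.


(** * Rademacher averages *)

Section rademacher.
Variable R : realType.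

(** For |x| <= 1/2 the bounds exp(x) <= 1/(1-x) and exp(-x) <= 1/(1+x) add up to
    2/(1-x^2); for larger x, |x| <= 2x^2. *)
Lemma expRD_expRN_le (x : R) : expR x + expR (- x) <= 2 * expR (2 * x ^+ 2).
Proof.
have [x2|/ltW x2] := leP `|x| 2^-1.
  have {}x2 : - 2^-1 <= x <= 2^-1 by rewrite -ler_norml.
  have inv_bound (y : R) : - 2^-1 <= y <= 2^-1 -> expR y <= (1 - y)^-1.
    move=> y2; have := expR_ge1Dx (- y) => h.
    by rewrite -[expR y]invrK lef_pV2 ?posrE -?expRN ?expR_gt0//; lra.
  have h1 := inv_bound x x2; case/andP: x2 => xl xu.
  have := inv_bound (- x); rewrite opprK => /(_ ltac:(lra)) h2.
  have x24 : x ^+ 2 <= 4^-1.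
    by have : 0 <= (2^-1 - x) * (2^-1 + x) by [rewrite mulr_ge0//; lra]; rewrite expr2; lra.
  apply: (@le_trans _ _ (2 * (1 + 2 * x ^+ 2))); last first.
    by rewrite ler_pM2l// expR_ge1Dx.
  apply: le_trans (lerD h1 h2) _.
  have -> : (1 - x)^-1 + (1 + x)^-1 = 2 / (1 - x ^+ 2).
    by field; apply/and3P; split; rewrite gt_eqF//; lra.
  by rewrite ler_pdivrMr; nra.
have xx : `|x| <= 2 * x ^+ 2 by rewrite -(real_normK (num_real x)); nra.
have /andP[h1 h2] : - (2 * x ^+ 2) <= x <= 2 * x ^+ 2 by rewrite -ler_norml.
have h3 : expR x <= expR (2 * x ^+ 2) by rewrite ler_expR.
have h4 : expR (- x) <= expR (2 * x ^+ 2) by rewrite ler_expR; lra.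
lra.
Qed.

Lemma rademacher_mgf n (a : 'I_n -> R) :
  \sum_(e : {ffun 'I_n -> bool}) expR (\sum_i (-1) ^+ e i * a i)
  <= 2 ^+ n * expR (2 * \sum_i a i ^+ 2).
Proof.
under eq_bigr do rewrite expR_sum.
rewrite -(bigA_distr_bigA (fun i (b : bool) => expR ((-1) ^+ b * a i)))/=.
rewrite mulr_sumr expR_sum.
have -> : (2 : R) ^+ n = \prod_(i < n) 2 by rewrite prodr_const card_ord.
rewrite -big_split/=.
apply: ler_prod => i _; rewrite big_bool/= expr1 expr0 mulN1r mul1r.
by rewrite addr_ge0 ?expR_ge0//= addrC expRD_expRN_le.
Qed.

(** Converts exponential moments into second moments: a maximum of squares is
    bounded by L^2 plus a sum of exponentials, each discounted by exp(-2L). *)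
Lemma sqr_le_expR (u L : R) : 0 <= u -> u ^+ 2 <= 8 * L ^+ 2 + 4 * expR (u - 2 * L).
Proof.
move=> u0; have e0 := expR_ge0 (u - 2 * L).
have [uL|/ltW Lu] := leP u (2 * L); first by nra.
have := @expR_ge1Dxn R (u - 2 * L) 1; rewrite subr_ge0 Lu => /(_ isT).
rewrite (_ : 2`!%:R = 2 :> R)//; have := sqr_ge0 (u - 4 * L); nra.
Qed.

(** With L = 1 + ln #|J| and lam^2 = L/(2V), each exponential moment of lam S_j is
    at most exp(L), and the sum over J and both signs of the discounted
    exponentials of [sqr_le_expR] is at most 2 #|J| exp(L - 2L) < 1.  So the mean of
    lam^2 max_j S_j^2 is O(L^2), that is, the mean of max_j S_j^2 is O(L V). *)
Lemma rademacher_max n (J : finType) (a : J -> 'I_n -> R) (A : 'I_n -> R) :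
  (0 < #|J|)%N -> (forall j i, `|a j i| <= A i) ->
  \sum_(e : {ffun 'I_n -> bool})
     \big[Num.max/0]_j (\sum_i (-1) ^+ e i * a j i) ^+ 2
  <= 2 ^+ n * (32 * (1 + ln #|J|%:R) * \sum_i A i ^+ 2).
Proof.
move=> J0 aA.
set L := 1 + ln #|J|%:R; set V := \sum_i A i ^+ 2.
have L1 : 1 <= L by rewrite lerDl ln_ge0// ler1n.
have A0 i : 0 <= A i.
  have [j _] : {j : J | j \in J} by apply/sig_eqW/card_gt0P.
  exact: le_trans (aA j i).
have V0 : 0 <= V by apply: sumr_ge0 => i _; rewrite sqr_ge0.
have [V_0|Vn0] := eqVneq V 0.
  have A_0 i : A i = 0.
    apply/eqP; rewrite -sqrf_eq0; apply/eqP.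
    by move: V_0 => /psumr_eq0P ->// k _; rewrite sqr_ge0.
  rewrite V_0 !mulr0 sumr_le0// => e _; apply: bigmax_le => // j _.
  rewrite big1 ?expr0n// => i _; have := aA j i.
  by rewrite A_0 normr_le0 => /eqP ->; rewrite mulr0.
have {Vn0}V0 : 0 < V by rewrite lt_neqAle eq_sym Vn0.
pose lam := Num.sqrt (L / (2 * V)).
have lam2 : lam ^+ 2 = L / (2 * V) by rewrite sqr_sqrtr// divr_ge0; lra.
have lam0 : 0 <= lam by exact: sqrtr_ge0.
have lam20 : 0 < lam ^+ 2 by rewrite lam2 divr_gt0; lra.
pose S (e : {ffun 'I_n -> bool}) j := \sum_i (-1) ^+ e i * a j i.
have mgf (c : R) j : c ^+ 2 = 1 ->
    \sum_(e : {ffun 'I_n -> bool}) expR (c * lam * S e j - 2 * L) <= 2 ^+ n * expR (- L).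
  move=> c1; under eq_bigr do rewrite expRD.
  rewrite -mulr_suml.
  have -> : expR (- L) = expR L * expR (- (2 * L)) by rewrite -expRD; congr expR; lra.
  rewrite mulrA ler_wpM2r ?expR_ge0//.
  have := rademacher_mgf (fun i => c * lam * a j i).
  under eq_bigr => e _.
    under eq_bigr do rewrite mulrCA.
    rewrite -mulr_sumr -/(S e j).
    over.
  move=> /le_trans; apply; rewrite ler_wpM2l ?exprn_ge0// ler_expR.
  under eq_bigr do rewrite !exprMn c1 mul1r.
  rewrite -mulr_sumr lam2.
  have : \sum_i a j i ^+ 2 <= V.
    apply: ler_sum => i _; rewrite -(real_normK (num_real (a j i))).
    by rewrite ler_pXn2r ?nnegrE// (le_trans _ (aA j i)).
  move=> h; rewrite mulrA -ler_pdivlMl; last by rewrite mulr_gt0// divr_gt0; lra.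
  by apply: (le_trans h); rewrite le_eqVlt; apply/orP; left; apply/eqP; field; lra.
have pt (e : {ffun 'I_n -> bool}) : lam ^+ 2 * \big[Num.max/0]_j (S e j) ^+ 2 <=
    8 * L ^+ 2 + \sum_j 4 * (expR (1 * lam * S e j - 2 * L) +
                             expR ((-1) * lam * S e j - 2 * L)).
  have rhs0 : 0 <= \sum_j 4 * (expR (1 * lam * S e j - 2 * L) +
                               expR ((-1) * lam * S e j - 2 * L)).
    by apply: sumr_ge0 => j _; rewrite mulr_ge0// addr_ge0// expR_ge0.
  rewrite -ler_pdivlMl//; apply: bigmax_le => [|j _].
    have := sqr_ge0 L => L20; apply: mulr_ge0; first by rewrite invr_ge0 ltW.
    by lra.
  rewrite ler_pdivlMl//.
  have -> : lam ^+ 2 * S e j ^+ 2 = (lam * `|S e j|) ^+ 2.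
    by rewrite exprMn -[in RHS]normrX ger0_norm// sqr_ge0.
  apply: le_trans (sqr_le_expR L _) _; first by rewrite mulr_ge0.
  rewrite lerD2l (bigD1 j)//= -[leLHS]addr0 lerD//; last first.
    by apply: sumr_ge0 => k _; rewrite mulr_ge0// addr_ge0// expR_ge0.
  rewrite ler_pM2l//; case: (ger0P (S e j)) => _.
    by rewrite mul1r lerDl expR_ge0.
  by rewrite mulN1r mulrN mulNr lerDr expR_ge0.
have tot : lam ^+ 2 * \sum_e \big[Num.max/0]_j (S e j) ^+ 2 <= 2 ^+ n * (16 * L ^+ 2).
  rewrite mulr_sumr; apply: le_trans (ler_sum _ (fun e _ => pt e)) _.
  rewrite big_split/= exchange_big/=.
  apply: (@le_trans _ _ (2 ^+ n * (8 * L ^+ 2) +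
                         \sum_(j : J) 4 * (2 * (2 ^+ n * expR (- L))))).
    apply: lerD.
      by rewrite sumr_const card_ffun card_bool card_ord -[leLHS]mulr_natl natrX lexx.
    apply: ler_sum => j _; rewrite -mulr_sumr ler_pM2l// big_split/=.
    have := mgf 1 j; have := mgf (-1) j; rewrite sqrrN expr1n => /(_ erefl) h1 /(_ erefl) h2.
    lra.
  rewrite sumr_const -(mulr_natl (4 * _)).
  have -> : #|J|%:R = expR (L - 1).
    by rewrite /L [1 + _]addrC addrK lnK// posrE ltr0n.
  have : expR (L - 1) * expR (- L) <= 1.
    by rewrite -expRD expR_le1; lra.
  have t0 : 0 < (2 : R) ^+ n by rewrite exprn_gt0.
  set E1 := expR (L - 1); set E2 := expR (- L) => hE.
  have -> : E1 * (4 * (2 * (2 ^+ n * E2))) = 2 ^+ n * (8 * (E1 * E2)) by ring.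
  by rewrite -mulrDr ler_pM2l//; nra.
rewrite -(ler_pM2l lam20); apply: (le_trans tot).
rewrite lam2 le_eqVlt; apply/orP; left; apply/eqP; field; lra.
Qed.

End rademacher.


(** * Independence *)

Section independence.
Context (R : realType) (d : measure_display) (T : measurableType d)
        (P : probability T R).
Local Open Scope ereal_scope.

(** Independence makes the joint law of U and V a product measure, so Fubini
    integrates v first. *)
Lemma integral_mul_indep0 d1 d2 (S1 : measurableType d1) (S2 : measurableType d2)
    (U : {RV P >-> S1}) (V : {RV P >-> S2}) (u : S1 -> R) (v : S2 -> R) :
  measurable_fun setT u -> measurable_fun setT v ->
  (forall A B, measurable A -> measurable B ->
     P (U @^-1` A `&` V @^-1` B) = P (U @^-1` A) * P (V @^-1` B)) ->
  P.-integrable setT (fun w => (u (U w))%:E) ->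
  P.-integrable setT (fun w => (v (V w))%:E) ->
  \int[P]_w (v (V w))%:E = 0 ->
  P.-integrable setT (fun w => (u (U w) * v (V w))%R%:E) /\
  \int[P]_w (u (U w) * v (V w))%R%:E = 0.
Proof.
move=> mu mv ind iu iv v0.
have mphi : measurable_fun setT (fun w => (U w, V w)).
  by apply: measurable_fun_pair; exact: measurable_funP.
pose W : {mfun T >-> (S1 * S2)%type} :=
  HB.pack (fun w => (U w, V w)) (isMeasurableFun.Build _ _ _ _ _ mphi).
pose f (z : S1 * S2) : \bar R := (u z.1 * v z.2)%R%:E.
have mf : measurable_fun setT f.
  by apply/measurable_EFinP; apply: measurable_funM; exact: measurableT_comp.
have mu' : measurable_fun setT (EFin \o u) by exact/measurable_EFinP.
have mv' : measurable_fun setT (EFin \o v) by exact/measurable_EFinP.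
have eqm A : measurable A -> (distribution P U \x distribution P V) A = distribution P W A.
  move=> mA; apply: product_measure_unique => [B C mB mC|]; last exact: mA.
  exact: (ind B C mB mC).
have iV : (distribution P V).-integrable setT (EFin \o v).
  by apply: integrable_pushforward.
have eV : \int[distribution P V]_y (v y)%:E = 0.
  by rewrite integral_pushforward.
have eU : \int[distribution P U]_x `|(u x)%:E| < +oo.
  rewrite ge0_integral_pushforward//=; first by case/integrableP : iu.
  by apply/measurable_EFinP; exact: measurableT_comp.
have iprod : (distribution P U \x distribution P V).-integrable setT f.
  have V0 : 0 <= \int[distribution P V]_y `|(v y)%:E| by apply: integral_ge0.
  apply/integrable12ltyP => //.
  have -> : \int[distribution P U]_x \int[distribution P V]_y `|f (x, y)| =
      \int[distribution P U]_x (`|(u x)%:E| * \int[distribution P V]_y `|(v y)%:E|).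
    apply: eq_integral => x _; rewrite -ge0_integralZl//; last exact: measurableT_comp.
    by apply: eq_integral => y _; rewrite -abseM.
  rewrite ge0_integralZr//; last exact: measurableT_comp.
  have U0 : 0 <= \int[distribution P U]_x `|(u x)%:E| by apply: integral_ge0.
  apply: lte_mul_pinfty; [exact: U0| |by case/integrableP : iV].
  by rewrite ge0_fin_numE; [exact: eU|exact: U0].
have iW : (distribution P W).-integrable setT f.
  apply/integrableP; split => //.
  case/integrableP : iprod => _; apply: le_lt_trans.
  rewrite le_eqVlt; apply/orP; left; apply/eqP.
  by apply: eq_measure_integral => A mA _; exact/esym/eqm.
have iuv : P.-integrable setT (fun w => (u (U w) * v (V w))%R%:E).
  apply/integrableP; split; first exact: (measurableT_comp mf mphi).
  case/integrableP : iW => _.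
  rewrite ge0_integral_pushforward//; exact: measurableT_comp.
split => //.
have -> : \int[P]_w (u (U w) * v (V w))%R%:E = \int[distribution P W]_z f z.
  by rewrite integral_pushforward.
transitivity (\int[distribution P U \x distribution P V]_z f z).
  by apply: eq_measure_integral => A mA _; exact/esym/eqm.
rewrite -integral12_prod_meas1//=.
apply: integral0_eq => x _; rewrite /fubini_F.
transitivity ((u x)%:E * \int[distribution P V]_y (v y)%:E); last by rewrite eV mule0.
by rewrite -integralZl.
Qed.

Section sigma_past.
Context (d' : measure_display) (S : measurableType d') (n : nat)
        (X : 'I_n -> {RV P >-> S}) (I : {set 'I_n}).

(** A pi-system generating the sigma-algebra of the variables with index in I.
    Functions of these variables are handled as measurable functions on T
    equipped with that sigma-algebra. *)
Definition cylinders : set (set T) :=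
  [set B | exists2 A : 'I_n -> set S, (forall i, measurable (A i)) &
     B = \bigcap_(i in [set` I]) X i @^-1` A i].

Lemma cylinders_measurable (B : set T) : <<s cylinders >> B -> measurable B.
Proof.
apply: smallest_sub => [|_ [A mA ->]]; first exact: sigma_algebra_measurable.
apply: fin_bigcap_measurable => // i _.
by rewrite -[X in measurable X]setTI; apply: measurable_funP.
Qed.

Lemma cylinders_setI : setI_closed cylinders.
Proof.
move=> _ _ [A mA ->] [B mB ->]; exists (fun i => A i `&` B i).
  by move=> i; exact: measurableI.
by rewrite -bigcapI.
Qed.

Lemma measurable_fun_cylinders d2 (U : measurableType d2)
    (u : g_sigma_algebraType cylinders -> U) :
  measurable_fun setT u -> measurable_fun setT (u : T -> U).
Proof.
move=> mu _ B mB; apply: cylinders_measurable.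
exact: (mu measurableT B mB).
Qed.

Lemma measurable_fun_component i : i \in I ->
  measurable_fun setT (X i : g_sigma_algebraType cylinders -> S).
Proof.
move=> iI _ B mB; rewrite setTI; apply: sub_gen_smallest.
exists (fun j => if j == i then B else setT); first by move=> j; case: ifP.
apply/seteqP; split => [w Bw j|w]; last by move=> /(_ i iI); rewrite eqxx.
by move=> jI /=; case: eqP => // ->.
Qed.

Hypothesis indX : mutually_independent X.

(** Mutual independence is the case of a cylinder B; Dynkin's theorem does the
    rest. *)
Lemma cylinders_indep (k : 'I_n) (C : set S) (B : set T) : k \notin I ->
  measurable C -> <<s cylinders >> B ->
  P (B `&` X k @^-1` C) = P B * P (X k @^-1` C).
Proof.
move=> kI mC.
have mXC : measurable (X k @^-1` C).
  by rewrite -[X in measurable X]setTI; apply: measurable_funP.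
pose Pr (B : set (g_sigma_algebraType cylinders)) :=
  P (B `&` X k @^-1` C) = P B * P (X k @^-1` C).
apply: (@dynkin_induction _ (g_sigma_algebraType cylinders) cylinders Pr) => //.
- exact: cylinders_setI.
- by rewrite /Pr setTI (probability_setT P) mul1e.
- move=> _ [A mA ->]; rewrite /Pr.
  pose J : {fset 'I_n} := [fset i | i in I]%fset.
  have IJ : [set` J] = [set` I].
    by apply/seteqP; split => i; rewrite /= !inE.
  have kJ : k \notin J by rewrite !inE.
  pose A' i := if i == k then C else A i.
  have A'A i : i \in I -> A' i = A i.
    by move=> iI; rewrite /A'; case: eqP => // ik; rewrite -ik iI in kI.
  have mA' i : measurable (A' i) by rewrite /A'; case: ifP.
  have eqI : \bigcap_(i in [set` I]) X i @^-1` A i = \bigcap_(i in [set` J]) X i @^-1` A' i.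
    by rewrite IJ; apply: eq_bigcapr => i /= iI; rewrite A'A.
  have -> : \bigcap_(i in [set` I]) X i @^-1` A i `&` X k @^-1` C =
      \bigcap_(i in [set` (k |` J)%fset]) X i @^-1` A' i.
    rewrite eqI; apply/seteqP; split => [w [Jw kw] i|w Jw].
      by rewrite /= in_fset1U => /orP[/eqP ->|/Jw//]; rewrite /A' eqxx.
    split => [i iJ|]; first by apply: Jw; rewrite /= in_fset1U iJ orbT.
    by have := Jw k; rewrite /= in_fset1U eqxx/A' eqxx; apply.
  rewrite eqI !indX// big_fsetU1//= muleC.
  by rewrite /A' eqxx.
- move=> D /cylinders_measurable mD; rewrite /Pr => PD.
  have -> : ~` D `&` X k @^-1` C = X k @^-1` C `\` D by rewrite setIC setDE.
  rewrite measureD//=; last by rewrite (le_lt_trans (probability_le1 P _))// ltry.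
  rewrite setIC PD probability_setC// muleBl ?mul1e ?fin_num_measure//.
- move=> F mF tF PF; rewrite /Pr setI_bigcupl.
  rewrite measure_bigcup//=; last 2 first.
  - by move=> i _; apply: measurableI => //; apply: cylinders_measurable; exact: mF.
  - exact: trivIset_setIr.
  rewrite measure_bigcup//=; last by move=> i _; apply: cylinders_measurable; exact: mF.
  have Pfin : P (X k @^-1` C) \is a fin_num by rewrite fin_num_measure.
  rewrite muleC -[X in X * _](fineK Pfin) -nneseriesZl//; apply: eq_eseriesr => i _.
  by rewrite fineK// PF muleC.
Qed.

End sigma_past.
End independence.


(** * Expectations of real functions *)

Section real_expectation.
Context (R : realType) (d : measure_display) (T : measurableType d)
        (P : probability T R).
Local Notation L1 f := (P.-integrable [set: T] (EFin \o f)).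
Implicit Types f g : T -> R.

Lemma L1_le f g : measurable_fun setT f -> L1 g -> (forall w, `|f w| <= g w) -> L1 f.
Proof.
move=> mf ig fg; apply: le_integrable ig => //; first exact/measurable_EFinP.
by move=> w _ /=; rewrite lee_fin (le_trans (fg w))// ler_norm.
Qed.

Lemma L1_cst (c : R) : L1 (cst c).
Proof. exact: (finite_measure_integrable_cst P c). Qed.

Lemma L1D f g : L1 f -> L1 g -> L1 (fun w => f w + g w).
Proof. by move=> h1 h2; apply: (integrableD _ h1 h2). Qed.

Lemma L1Z (c : R) f : L1 f -> L1 (fun w => c * f w).
Proof. by move=> h1; apply: (integrableZl _ c h1). Qed.

Lemma L1_sum (I : Type) (s : seq I) (p : pred I) (h : I -> T -> R) :
  (forall i, p i -> L1 (h i)) -> L1 (fun w => \sum_(i <- s | p i) h i w).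
Proof.
move=> H; have := @integrable_sum _ _ _ P setT measurableT I s p (fun i => EFin \o h i) H.
by apply: eq_integrable => // w _ /=; rewrite -sumEFin.
Qed.

Lemma Rintegral_sum (I : Type) (s : seq I) (p : pred I) (h : I -> T -> R) :
  (forall i, p i -> L1 (h i)) ->
  \int[P]_w (\sum_(i <- s | p i) h i w) = \sum_(i <- s | p i) \int[P]_w h i w.
Proof.
move=> H; elim: s => [|i s IH].
  under eq_Rintegral do rewrite big_nil.
  by rewrite Rintegral_cst// mul0r big_nil.
rewrite big_cons -IH; case: ifPn => [pi|npi].
  under eq_Rintegral do rewrite big_cons pi.
  by rewrite RintegralD//; [exact: H|exact: L1_sum].
by under eq_Rintegral do rewrite big_cons (negbTE npi).
Qed.

Lemma Rintegral_prob_cst (c : R) : \int[P]_w c = c.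
Proof. by rewrite Rintegral_cst// (congr1 fine (probability_setT P)) mulr1. Qed.

Lemma L1_sqr f : measurable_fun setT f -> L1 (fun w => f w ^+ 2) -> L1 f.
Proof.
move=> mf i2; apply: (L1_le mf (L1D (L1_cst 1) i2)) => w /=.
by rewrite -(real_normK (num_real (f w))); have := sqr_ge0 (`|f w| - 1); nra.
Qed.

Lemma le_expect f g : L1 f -> L1 g -> (forall w, f w <= g w) ->
  \int[P]_w f w <= \int[P]_w g w.
Proof. by move=> h1 h2 fg; apply: le_Rintegral. Qed.

End real_expectation.

(** * A maximal inequality for independent sums *)

Lemma sqr_sum_le (R : realType) n (a : 'I_n -> R) :
  (\sum_i a i) ^+ 2 <= n%:R * \sum_i a i ^+ 2.
Proof.
have : 0 <= \sum_i \sum_j (a i - a j) ^+ 2.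
  by apply: sumr_ge0 => i _; apply: sumr_ge0 => j _; rewrite sqr_ge0.
have inner i : \sum_j (a i - a j) ^+ 2 =
    n%:R * a i ^+ 2 - 2 * a i * (\sum_j a j) + \sum_j a j ^+ 2.
  rewrite mulr_sumr (_ : n%:R * _ = \sum_(j < n) a i ^+ 2); last first.
    by rewrite sumr_const card_ord mulr_natl.
  by rewrite -sumrB -big_split/=; apply: eq_bigr => j _; ring.
under eq_bigr do rewrite inner.
rewrite big_split/= sumrB -mulr_sumr -mulr_suml -mulr_sumr.
rewrite (_ : \sum_(j < n) (\sum_k a k ^+ 2) = n%:R * \sum_k a k ^+ 2); last first.
  by rewrite sumr_const card_ord mulr_natl.
by rewrite expr2; lra.
Qed.

Section selectors.
Context (R : realType) (d : measure_display) (S : measurableType d) (J : eqType).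

Lemma measurable_bigmax (U : J -> S -> R) (r : seq J) :
  (forall j, measurable_fun setT (U j)) ->
  measurable_fun setT (fun w => \big[Num.max/0]_(j <- r) U j w).
Proof.
move=> mU; elim: r => [|j r IH].
  under eq_fun do rewrite big_nil.
  exact: measurable_cst.
under eq_fun do rewrite big_cons.
exact: (measurable_maxr (mU j) IH).
Qed.

(** A measurable choice of an index maximising U_k^2, encoded by the functions s_k
    that equal U_k at the chosen index and vanish at the others. *)
Lemma measurable_argmax (U : J -> S -> R) (j0 : J) (r : seq J) :
  (forall j, measurable_fun setT (U j)) ->
  exists2 s : J -> S -> R, (forall j, measurable_fun setT (s j)) &
    forall w, exists j, (forall k, s k w = (k == j)%:R * U k w) /\
      \big[Num.max/0]_(k <- j0 :: r) U k w ^+ 2 = U j w ^+ 2.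
Proof.
move=> mU; elim: r => [|j r [s ms IH]].
  exists (fun k w => (k == j0)%:R * U k w) => [k|w].
    by apply: measurable_funM.
  by exists j0; split => //; rewrite big_cons big_nil (max_idPl _)// sqr_ge0.
pose M w := \big[Num.max/0]_(k <- j0 :: r) U k w ^+ 2.
have mM : measurable_fun setT M.
  by apply: measurable_bigmax => k; exact: measurable_funX.
exists (fun k w => if M w <= U j w ^+ 2 then (k == j)%:R * U k w else s k w).
  move=> k; apply: measurable_fun_ifT => //; last exact: measurable_funM.
  by apply: measurable_fun_ler => //; exact: measurable_funX.
move=> w; have -> : \big[Num.max/0]_(k <- [:: j0, j & r]) U k w ^+ 2 =
    Num.max (U j w ^+ 2) (M w).
  by rewrite /M !big_cons maxCA.
case: leP => h; first by exists j.
by have [k [sk Mk]] := IH w; exists k.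
Qed.

End selectors.

Section maximal_inequality.
Context (R : realType) (d : measure_display) (T : measurableType d)
        (P : probability T R).
Local Notation L1 f := (P.-integrable [set: T] (EFin \o f)).
Context (d' : measure_display) (S : measurableType d') (n : nat)
        (X : 'I_n -> {RV P >-> S}) (J : finType) (g : J -> S -> R) (H : S -> R).
Hypotheses (indX : mutually_independent X) (J0 : (0 < #|J|)%N)
  (mg : forall j, measurable_fun setT (g j)) (mH : measurable_fun setT H)
  (gH : forall j y, `|g j y| <= H y)
  (H2 : forall i, L1 (fun w => H (X i w) ^+ 2))
  (g0 : forall j i, \int[P]_w g j (X i w) = 0).

Let ws (c : 'I_n -> R) j w := \sum_i c i * g j (X i w).
Let mx (c : 'I_n -> R) w := \big[Num.max/0]_j ws c j w ^+ 2.

Let mX i : measurable_fun setT (X i). Proof. exact: measurable_funP. Qed.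

Let mgX j i : measurable_fun setT (fun w => g j (X i w)).
Proof. exact: measurableT_comp. Qed.

Let mws c j : measurable_fun setT (ws c j).
Proof. by apply: measurable_sum => i; exact: measurable_funM. Qed.

Let H1 i : L1 (fun w => H (X i w)).
Proof. by apply: L1_sqr => //; exact: measurableT_comp. Qed.

Let g1 j i : L1 (fun w => g j (X i w)).
Proof. by apply: (L1_le _ (H1 i)) => // w; exact: gH. Qed.

Let mx_le c w : (forall i, `|c i| <= 1) -> mx c w <= n%:R * \sum_i H (X i w) ^+ 2.
Proof.
move=> c1; have rhs0 : 0 <= n%:R * \sum_i H (X i w) ^+ 2.
  by rewrite mulr_ge0// sumr_ge0// => i _; exact: sqr_ge0.
apply: bigmax_le => // j _; apply: le_trans (sqr_sum_le _) _.
rewrite ler_wpM2l// ler_sum// => i _; rewrite -(real_normK (num_real _)).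
have h0 : 0 <= H (X i w) by exact: le_trans (gH j _).
rewrite ler_pXn2r ?nnegrE// normrM -[leRHS]mul1r.
by apply: ler_pM.
Qed.

Let mx_ge0 c w : 0 <= mx c w. Proof. exact: bigmax_ge_id. Qed.

Let L1_mx c : (forall i, `|c i| <= 1) -> L1 (mx c).
Proof.
move=> c1; apply: (@L1_le _ _ _ _ _ (fun w => n%:R * \sum_i H (X i w) ^+ 2)).
- by apply: measurable_bigmax => j; exact: measurable_funX.
- by apply: L1Z; apply: L1_sum => i _; exact: H2.
- by move=> w; rewrite ger0_norm//; exact: mx_le.
Qed.

Let ind (A : {set 'I_n}) (i : 'I_n) : R := (i \in A)%:R.
Let sgn (A : {set 'I_n}) (i : 'I_n) : R := (-1) ^+ (i \notin A).

Let ind1 A i : `|ind A i| <= 1.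
Proof. by rewrite /ind; case: (_ \in _); rewrite ?normr1 ?normr0. Qed.

Let sgn1 A i : `|sgn A i| <= 1.
Proof. by rewrite normrX normrN1 expr1n. Qed.

(** Symmetrization for a fixed choice of signs.  Let U_j and W_j be the sums over
    A and over its complement, and let j be the measurable argmax of U_j^2.  Then
    U_j^2 <= (U_j - W_j)^2 + 2 U_j W_j, and the last term, whose first factor
    depends only on the variables in A, has mean zero by independence. *)
Let symm A : \int[P]_w mx (ind A) w <= \int[P]_w mx (sgn A) w.
Proof.
have [j0 _] : {j : J | j \in J} by apply/sig_eqW/card_gt0P.
pose TA : measurableType _ := g_sigma_algebraType (cylinders X A).
pose U j : TA -> R := ws (ind A) j.
have mU j : measurable_fun setT (U j).
  apply: measurable_sum => i; rewrite /ind.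
  have [iA|iA] := boolP (i \in A).
    apply: measurable_funM => //; apply: measurableT_comp => //.
    exact: measurable_fun_component.
  under eq_fun do rewrite mul0r.
  exact: measurable_cst.
have [s ms sP] := measurable_argmax j0 (enum J) mU.
have mxE w : exists j, (forall k, s k w = (k == j)%:R * U k w) /\ mx (ind A) w = U j w ^+ 2.
  have [j [sj e]] := sP w; exists j; split => //; rewrite -e /mx.
  rewrite big_cons big_enum/=; apply/esym/max_idPr.
  exact: (@le_bigmax _ _ _ 0 (fun j => ws (ind A) j w ^+ 2)).
have pt w : mx (ind A) w <=
    mx (sgn A) w + 2 * \sum_j s j w * (\sum_(i | i \notin A) g j (X i w)).
  have [j [sj ->]] := mxE w.
  rewrite (bigD1 j)//= [X in 2 * (_ + X)]big1 ?addr0; last first.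
    by move=> k kj; rewrite sj (negbTE kj) !mul0r.
  rewrite sj eqxx mul1r; set W := \sum_(i | _) _.
  apply: (@le_trans _ _ ((U j w - W) ^+ 2 + 2 * (U j w * W))).
    by rewrite sqrrB; have := sqr_ge0 W; lra.
  rewrite lerD2r; suff -> : U j w - W = ws (sgn A) j w by exact: le_bigmax.
  rewrite /W big_mkcond/= -sumrB; apply: eq_bigr => i _; rewrite /ind /sgn.
  by case: (i \in A) => /=; rewrite ?expr0 ?expr1; lra.
have sint j i : i \notin A -> L1 (fun w => s j w * g j (X i w)) /\
    \int[P]_w (s j w * g j (X i w)) = 0.
  move=> iA.
  have mid : measurable_fun setT (id : T -> TA).
    by move=> _ B mB; rewrite setTI; exact: (cylinders_measurable mB).
  pose idA : {RV P >-> TA} := HB.pack (id : T -> TA) (isMeasurableFun.Build _ _ _ _ _ mid).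
  have [||||h1 h2] :=
    @integral_mul_indep0 _ _ _ P _ _ TA S idA (X i) (s j) (g j) (ms j) (mg j).
  - by move=> B C mB mC; exact: (cylinders_indep indX iA mC mB).
  - apply: (@L1_le _ _ _ P _ (fun w => \sum_i H (X i w))).
    + exact: measurable_fun_cylinders (ms j).
    + by apply: L1_sum => k _; exact: H1.
    + move=> w; have [k [sk _]] := mxE w; rewrite sk.
      apply: (@le_trans _ _ `|U j w|).
        by rewrite normrM ler_piMl//; case: eqP; rewrite ?normr1 ?normr0.
      apply: le_trans (ler_norm_sum _ _ _) _; apply: ler_sum => l _.
      rewrite normrM -[leRHS]mul1r; apply: ler_pM => //.
  - exact: g1.
  - by rewrite -[LHS]fineK ?integrable_fin_num//; [congr EFin; exact: g0|exact: g1].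
  by split => //; rewrite /Rintegral h2.
have i2 : L1 (fun w => 2 * \sum_j s j w * (\sum_(i | i \notin A) g j (X i w))).
  apply: L1Z; apply: L1_sum => j _; under eq_fun do rewrite mulr_sumr.
  by apply: L1_sum => i iA; case: (sint j i iA).
apply: le_trans (le_expect (L1_mx (ind1 A)) (L1D (L1_mx (sgn1 A)) i2) pt) _.
rewrite RintegralD//; last exact: L1_mx.
suff -> : \int[P]_w (2 * \sum_j s j w * (\sum_(i | i \notin A) g j (X i w))) = 0.
  by rewrite addr0.
have i3 j : L1 (fun w => s j w * (\sum_(i | i \notin A) g j (X i w))).
  under eq_fun do rewrite mulr_sumr.
  by apply: L1_sum => i iA; case: (sint j i iA).
rewrite RintegralZl//; last by apply: L1_sum.
rewrite Rintegral_sum// big1 ?mulr0// => j _.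
under eq_Rintegral do rewrite mulr_sumr.
rewrite Rintegral_sum; last by move=> i iA; case: (sint j i iA).
by rewrite big1// => i iA; case: (sint j i iA).
Qed.

(** Splitting the sum along A and its complement and symmetrizing both parts
    bounds the left-hand side, for every A, by four times its analogue with the
    signs of A.  Averaging over all A brings in a Rademacher average at each point
    of the probability space. *)
Theorem indep_maximal_inequality :
  \int[P]_w (\big[Num.max/0]_j (\sum_i g j (X i w)) ^+ 2)
  <= 128 * (1 + ln #|J|%:R) * \sum_i \int[P]_w H (X i w) ^+ 2.
Proof.
pose one (i : 'I_n) : R := 1.
have one1 i : `|one i| <= 1 by rewrite normr1.
have -> : \int[P]_w (\big[Num.max/0]_j (\sum_i g j (X i w)) ^+ 2) = \int[P]_w mx one w.
  apply: eq_Rintegral => w _; apply: eq_bigr => j _.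
  by congr (_ ^+ 2); apply: eq_bigr => i _; rewrite mul1r.
have split A : \int[P]_w mx one w <= 4 * \int[P]_w mx (sgn A) w.
  have pt w : mx one w <= 2 * mx (ind A) w + 2 * mx (ind (~: A)) w.
    apply: bigmax_le => [|j _]; first by rewrite addr_ge0// mulr_ge0.
    have -> : ws one j w = ws (ind A) j w + ws (ind (~: A)) j w.
      rewrite /ws -big_split/=; apply: eq_bigr => i _.
      by rewrite /ind inE; case: (i \in A); rewrite /one/=; lra.
    have h1 : ws (ind A) j w ^+ 2 <= mx (ind A) w.
      exact: (@le_bigmax _ _ _ 0 (fun j => ws (ind A) j w ^+ 2)).
    have h2 : ws (ind (~: A)) j w ^+ 2 <= mx (ind (~: A)) w.
      exact: (@le_bigmax _ _ _ 0 (fun j => ws (ind (~: A)) j w ^+ 2)).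
    by have := sqr_ge0 (ws (ind A) j w - ws (ind (~: A)) j w); rewrite sqrrB sqrrD; lra.
  have sgnC : mx (sgn (~: A)) = mx (sgn A).
    apply/funext => w; apply: eq_bigr => j _; rewrite -sqrrN -sumrN.
    congr (_ ^+ 2); apply: eq_bigr => i _; rewrite /sgn inE.
    by case: (i \in A); rewrite /= ?expr0 ?expr1; lra.
  have := symm A; have := symm (~: A); rewrite sgnC.
  have := le_expect (L1_mx one1)
    (L1D (L1Z 2 (L1_mx (ind1 A))) (L1Z 2 (L1_mx (ind1 (~: A))))) pt.
  rewrite RintegralD//; [|exact/L1Z/L1_mx|exact/L1Z/L1_mx].
  rewrite !RintegralZl//; [|exact: L1_mx|exact: L1_mx].
  lra.
pose sg (e : {ffun 'I_n -> bool}) : {set 'I_n} := [set i | ~~ e i]%SET.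
have rad w : \sum_(e : {ffun 'I_n -> bool}) mx (sgn (sg e)) w
    <= 2 ^+ n * (32 * (1 + ln #|J|%:R) * \sum_i H (X i w) ^+ 2).
  have := @rademacher_max R n J (fun j i => g j (X i w)) (fun i => H (X i w)) J0
    (fun j i => gH j _).
  apply: le_trans; apply: ler_sum => e _; rewrite le_eqVlt; apply/orP; left; apply/eqP.
  apply: eq_bigr => j _; congr (_ ^+ 2); apply: eq_bigr => i _.
  by rewrite /sgn /sg inE negbK.
have t0 : 0 < (2 : R) ^+ n by rewrite exprn_gt0.
have iH : L1 (fun w => \sum_i H (X i w) ^+ 2) by apply: L1_sum => i _; exact: H2.
have tot : 2 ^+ n * \int[P]_w mx one w <=
    4 * (2 ^+ n * (32 * (1 + ln #|J|%:R) * \sum_i \int[P]_w H (X i w) ^+ 2)).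
  have -> : 2 ^+ n * (32 * (1 + ln #|J|%:R) * \sum_i \int[P]_w H (X i w) ^+ 2) =
      \int[P]_w (2 ^+ n * (32 * (1 + ln #|J|%:R) * \sum_i H (X i w) ^+ 2)).
    rewrite RintegralZl//; last exact: L1Z.
    rewrite RintegralZl// Rintegral_sum// => i _; exact: H2.
  have -> : 2 ^+ n * \int[P]_w mx one w = \sum_(e : {ffun 'I_n -> bool}) \int[P]_w mx one w.
    by rewrite sumr_const card_ffun card_bool card_ord -[RHS]mulr_natl natrX.
  apply: (@le_trans _ _ (4 * \sum_(e : {ffun 'I_n -> bool}) \int[P]_w mx (sgn (sg e)) w)).
    by rewrite mulr_sumr; apply: ler_sum.
  rewrite ler_pM2l// -Rintegral_sum; last by move=> e _; exact: L1_mx.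
  apply: le_expect => //; first by apply: L1_sum => e _; exact: L1_mx.
  by apply: L1Z; exact: L1Z.
rewrite -(ler_pM2l t0); apply: (le_trans tot); lra.
Qed.

End maximal_inequality.


(** * Chaining *)

Section second_moment.
Context (R : realType) (d : measure_display) (T : measurableType d)
        (P : probability T R).
Local Notation L1 f := (P.-integrable [set: T] (EFin \o f)).

Lemma sqrD_le_weighted (x y B b : R) : 0 < B -> 0 < b ->
  (x + y) ^+ 2 <= (B + b) / B * x ^+ 2 + (B + b) / b * y ^+ 2.
Proof.
move=> B0 b0; rewrite -subr_ge0.
have -> : (B + b) / B * x ^+ 2 + (B + b) / b * y ^+ 2 - (x + y) ^+ 2 =
    (b * x - B * y) ^+ 2 / (B * b) by field; rewrite !gt_eqF.
by rewrite divr_ge0 ?sqr_ge0// mulr_ge0// ltW.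
Qed.

(** The triangle inequality in L2, with norms bounded by sqrt(A) B and sqrt(A) b. *)
Lemma second_moment_add (u v : T -> R) (A B b : R) : 0 < B -> 0 < b ->
  measurable_fun setT u -> measurable_fun setT v ->
  L1 (fun w => u w ^+ 2) -> L1 (fun w => v w ^+ 2) ->
  \int[P]_w u w ^+ 2 <= A * B ^+ 2 -> \int[P]_w v w ^+ 2 <= A * b ^+ 2 ->
  L1 (fun w => (u w + v w) ^+ 2) /\
  \int[P]_w (u w + v w) ^+ 2 <= A * (B + b) ^+ 2.
Proof.
move=> B0 b0 mu mv iu iv Eu Ev.
pose F w := (B + b) / B * u w ^+ 2 + (B + b) / b * v w ^+ 2.
have iF : L1 F by apply: L1D; apply: L1Z.
have pt w : (u w + v w) ^+ 2 <= F w by exact: sqrD_le_weighted.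
have i : L1 (fun w => (u w + v w) ^+ 2).
  apply: (L1_le _ iF); first by apply: measurable_funX; exact: measurable_funD.
  by move=> w; rewrite ger0_norm ?sqr_ge0.
split => //; apply: le_trans (le_expect i iF pt) _.
rewrite RintegralD//; [|exact: L1Z|exact: L1Z]; rewrite !RintegralZl//.
apply: (@le_trans _ _ ((B + b) / B * (A * B ^+ 2) + (B + b) / b * (A * b ^+ 2))).
  by apply: lerD; rewrite ler_wpM2l// divr_ge0//; lra.
rewrite le_eqVlt; apply/orP; left; apply/eqP; field; by rewrite !gt_eqF.
Qed.

End second_moment.

Section chaining.
Context (R : realType) (Q : metricType R) (d : measure_display)
        (T : measurableType d) (P : probability T R).
Local Notation L1 f := (P.-integrable [set: T] (EFin \o f)).
Context (d' : measure_display) (S : measurableType d') (n : nat)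
        (X : 'I_n -> {RV P >-> S}) (g : Q -> Q -> S -> R) (H : S -> R) (L : R).
Hypotheses (n0 : (0 < n)%N) (indX : mutually_independent X)
  (mg : forall p q, measurable_fun setT (g p q)) (mH : measurable_fun setT H)
  (H0 : forall y, 0 <= H y) (L0 : 0 <= L)
  (gH : forall p q y, `|g p q y| <= L * mdist p q * H y)
  (gD : forall p q r y, g p q y + g q r y = g p r y)
  (H2 : forall i, L1 (fun w => H (X i w) ^+ 2))
  (g0 : forall p q i, \int[P]_w g p q (X i w) = 0).

Let V := \sum_i \int[P]_w H (X i w) ^+ 2.

Let V0 : 0 <= V.
Proof. by apply: sumr_ge0 => i _; apply: Rintegral_ge0 => w _; exact: sqr_ge0. Qed.

Let mX i : measurable_fun setT (X i). Proof. exact: measurable_funP. Qed.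

(** One link of the chain.  Pairs at distance more than r are replaced by the zero
    function, so that L r H serves as an envelope for the whole product of nets. *)
Lemma chaining_link (s1 s2 : seq Q) (r c : R) : 0 <= r ->
  (0 < size s1)%N -> (0 < size s2)%N ->
  1 + ln (size s1)%:R + ln (size s2)%:R <= c ^+ 2 ->
  exists u : T -> R, [/\ measurable_fun setT u, L1 (fun w => u w ^+ 2),
    (forall w, 0 <= u w),
    \int[P]_w u w ^+ 2 <= 128 * L ^+ 2 * V * (c * r) ^+ 2 &
    forall w p q, p \in s1 -> q \in s2 -> mdist p q <= r ->
      \sum_i g p q (X i w) <= u w].
Proof.
move=> r0 s10 s20 cP.
pose J : finType := ('I_(size s1) * 'I_(size s2))%type.
have [q0 _] : {q | q \in s1} by case: s1 s10 {cP J} => // q s1 _; exists q; exact: mem_head.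
pose p1 (j : J) := nth q0 s1 j.1; pose p2 (j : J) := nth q0 s2 j.2.
pose G (j : J) y := if mdist (p1 j) (p2 j) <= r then g (p1 j) (p2 j) y else 0.
pose K y := L * r * H y.
have J0 : (0 < #|J|)%N by rewrite card_prod !card_ord muln_gt0 s10 s20.
have mG j : measurable_fun setT (G j).
  rewrite /G; case: (mdist (p1 j) (p2 j) <= r); [exact: mg|exact: measurable_cst].
have GK j y : `|G j y| <= K y.
  rewrite /G /K; case: ifPn => [h|_]; last by rewrite normr0 !mulr_ge0.
  by apply: le_trans (gH _ _ _) _; rewrite ler_wpM2r// ler_wpM2l.
have mK : measurable_fun setT K by exact: measurable_funM.
have K2 i : L1 (fun w => K (X i w) ^+ 2).
  by under eq_fun do rewrite exprMn; exact: L1Z.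
have G0 j i : \int[P]_w G j (X i w) = 0.
  rewrite /G; case: (mdist (p1 j) (p2 j) <= r); first exact: g0.
  exact: Rintegral_prob_cst.
have := indep_maximal_inequality indX J0 mG mK GK K2 G0.
set M := fun w => \big[Num.max/0]_j (\sum_i G j (X i w)) ^+ 2 => hM.
have M0 w : 0 <= M w by exact: bigmax_ge_id.
have mM : measurable_fun setT M.
  apply: measurable_bigmax => j; apply: measurable_funX; apply: measurable_sum => i.
  exact: measurableT_comp.
have uu w : Num.sqrt (M w) ^+ 2 = M w by exact: sqr_sqrtr.
have iM : L1 M.
  apply: (@L1_le _ _ _ _ _ (fun w => n%:R * \sum_i K (X i w) ^+ 2)) => //.
    by apply: L1Z; apply: L1_sum.
  move=> w; rewrite ger0_norm//; apply: bigmax_le => [|j _].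
    by rewrite mulr_ge0// sumr_ge0// => i _; exact: sqr_ge0.
  apply: le_trans (sqr_sum_le _) _; rewrite ler_wpM2l// ler_sum// => i _.
  rewrite -(real_normK (num_real _)) ler_pXn2r ?nnegrE//.
  by rewrite !mulr_ge0.
exists (fun w => Num.sqrt (M w)); split.
- apply: measurableT_comp => //.
  by apply: continuous_measurable_fun; exact: sqrt_continuous.
- by under eq_fun do rewrite uu.
- by move=> w; exact: sqrtr_ge0.
- under eq_Rintegral do rewrite uu.
  apply: (le_trans hM).
  have -> : \sum_i \int[P]_w K (X i w) ^+ 2 = (L * r) ^+ 2 * V.
    rewrite mulr_sumr; apply: eq_bigr => i _; rewrite -RintegralZl//.
    by apply: eq_Rintegral => w _; rewrite exprMn.
  have -> : 128 * L ^+ 2 * V * (c * r) ^+ 2 = 128 * c ^+ 2 * ((L * r) ^+ 2 * V) by ring.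
  rewrite ler_wpM2r//; first by rewrite mulr_ge0// sqr_ge0.
  rewrite ler_pM2l// card_prod !card_ord natrM lnM ?posrE ?ltr0n//.
  by rewrite addrA.
- move=> w p q ps1 qs2 pq.
  have ip : (index p s1 < size s1)%N by rewrite index_mem.
  have iq : (index q s2 < size s2)%N by rewrite index_mem.
  pose j : J := (Ordinal ip, Ordinal iq).
  have -> : \sum_i g p q (X i w) = \sum_i G j (X i w).
    by apply: eq_bigr => i _; rewrite /G /p1 /p2/= !nth_index// pq.
  apply: le_trans (ler_norm _) _; rewrite -sqrtr_sqr ler_sqrt//.
  exact: (@le_bigmax _ _ _ 0 (fun j => (\sum_i G j (X i w)) ^+ 2)).
Qed.

(** A point q of the ball is joined to m through points pk k q of the nets, at
    distance at most delta / 2^k from q, for k <= K; consecutive ones are at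
    distance at most 3 delta / 2^(k+1), whence the constant 1152 = 128 * 3^2.  The
    last step, from pk K q to q, is not a maximum over a finite set; its bound rem
    by the sum of the envelopes contributes the term sqrt(n) / 2^K. *)
Lemma chaining (m : Q) (delta : R) (K : nat) (net : nat -> seq Q) (c : nat -> R) :
  0 <= delta -> net 0%N = [:: m] ->
  (forall k q, mdist m q <= delta ->
     exists2 p, p \in net k & mdist p q <= delta / 2 ^+ k) ->
  (forall k, 0 < c k) ->
  (forall k, 1 + ln (size (net k))%:R + ln (size (net k.+1))%:R <= c k.+1 ^+ 2) ->
  exists U : T -> R, [/\ measurable_fun setT U, L1 (fun w => U w ^+ 2),
    (forall w, 0 <= U w),
    \int[P]_w U w ^+ 2 <= 1152 * L ^+ 2 * V * delta ^+ 2 *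
      (Num.sqrt n%:R / 2 ^+ K + \sum_(k < K) c k.+1 / 2 ^+ k.+1) ^+ 2 &
    forall w q, mdist m q <= delta -> \sum_i g m q (X i w) <= U w].
Proof.
move=> delta0 net0 cover c0 entropy.
have two0 k : 0 < (2 : R) ^+ k by rewrite exprn_gt0.
have net_gt0 k : (0 < size (net k))%N.
  have [|p] := cover k m; first by rewrite mdistxx.
  by case: (net k).
pose pk k q : Q := if mdist m q <= delta is true then
  xget m [set p | p \in net k /\ mdist p q <= delta / 2 ^+ k] else m.
have pkP k q : mdist m q <= delta ->
    pk k q \in net k /\ mdist (pk k q) q <= delta / 2 ^+ k.
  move=> h; rewrite /pk h; have [p pn pd] := cover k q h.
  by apply: (@xgetPex _ m [set p | p \in net k /\ mdist p q <= delta / 2 ^+ k]); exists p.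
pose A := 1152 * L ^+ 2 * V * delta ^+ 2.
pose b0 := Num.sqrt n%:R / (2 : R) ^+ K.
have b00 : 0 < b0 by rewrite divr_gt0// sqrtr_gt0 ltr0n.
pose rem w := L * (delta / 2 ^+ K) * \sum_i H (X i w).
have rem0 w : 0 <= rem w.
  apply: mulr_ge0; last exact: sumr_ge0.
  by rewrite mulr_ge0// divr_ge0// ltW.
have mrem : measurable_fun setT rem.
  apply: measurable_funM => //; apply: measurable_sum => i; exact: measurableT_comp.
(* The remainder is put at the start of the induction, so that the weight in
   [second_moment_add] is positive from the first link on. *)
have step j : exists U : T -> R, [/\ measurable_fun setT U, L1 (fun w => U w ^+ 2),
    (forall w, 0 <= U w),
    \int[P]_w U w ^+ 2 <= A * (b0 + \sum_(k < j) c k.+1 / 2 ^+ k.+1) ^+ 2 &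
    forall w q, mdist m q <= delta -> \sum_i g m (pk j q) (X i w) + rem w <= U w].
  elim: j => [|j [U [mU iU U0 EU UP]]].
    have ptrem w : rem w ^+ 2 <=
        (L * (delta / 2 ^+ K)) ^+ 2 * (n%:R * \sum_i H (X i w) ^+ 2).
      by rewrite /rem exprMn ler_wpM2l ?sqr_ge0// sqr_sum_le.
    have iH : L1 (fun w => \sum_i H (X i w) ^+ 2) by exact: L1_sum.
    have irem : L1 (fun w => rem w ^+ 2).
      apply: (L1_le _ (L1Z _ (L1Z _ iH))); first exact: measurable_funX.
      by move=> w; rewrite ger0_norm ?sqr_ge0//; exact: ptrem.
    exists rem; split => //.
      apply: le_trans (le_expect irem (L1Z _ (L1Z _ iH)) ptrem) _.
      rewrite !RintegralZl//; last exact: L1Z.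
      rewrite Rintegral_sum// -/V big_ord0 addr0 /b0 /A.
      rewrite [in leRHS]exprMn sqr_sqrtr// -subr_ge0.
      have -> : 1152 * L ^+ 2 * V * delta ^+ 2 * (n%:R * 2 ^- K ^+ 2) -
         (L * (delta / 2 ^+ K)) ^+ 2 * (n%:R * V) =
         1151 * (L * (delta / 2 ^+ K)) ^+ 2 * (n%:R * V) by ring.
      apply: mulr_ge0; last by apply: mulr_ge0; [exact: ler0n|exact: V0].
      by apply: mulr_ge0; [exact: ler0n|exact: sqr_ge0].
    move=> w q mq; have [] := pkP 0%N q mq; rewrite net0 inE => /eqP -> _.
    rewrite (eq_bigr (fun=> 0)) ?sumr_const ?mul0rn ?add0r// => i _.
    by have := gD m m m (X i w); lra.
  have r0 : 0 <= 3 * (delta / 2 ^+ j.+1).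
    by rewrite mulr_ge0// divr_ge0// ltW.
  have [u [mu iu u0 Eu uP]] := chaining_link r0 (net_gt0 j) (net_gt0 j.+1) (entropy j).
  have B0 : 0 < b0 + \sum_(k < j) c k.+1 / 2 ^+ k.+1.
    by rewrite ltr_pwDl// sumr_ge0// => k _; rewrite ltW// divr_gt0.
  have b0' : 0 < c j.+1 / 2 ^+ j.+1 by rewrite divr_gt0.
  have Eu' : \int[P]_w u w ^+ 2 <= A * (c j.+1 / 2 ^+ j.+1) ^+ 2.
    apply: (le_trans Eu); rewrite le_eqVlt; apply/orP; left; apply/eqP.
    by rewrite /A; ring.
  have [i' E'] := second_moment_add B0 b0' mU mu iU iu EU Eu'.
  exists (fun w => U w + u w); split => //.
  - exact: measurable_funD.
  - by move=> w; rewrite addr_ge0.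
  - by rewrite big_ord_recr/= addrA.
  - move=> w q mq; have := UP w q mq.
    have [p1n p1d] := pkP j q mq; have [p2n p2d] := pkP j.+1 q mq.
    have dd : mdist (pk j q) (pk j.+1 q) <= 3 * (delta / 2 ^+ j.+1).
      apply: le_trans (metric_triangle _ q _) _; rewrite (metric_sym q).
      have -> : 3 * (delta / 2 ^+ j.+1) = delta / 2 ^+ j + delta / 2 ^+ j.+1.
        by rewrite exprS; field; rewrite gt_eqF.
      exact: lerD.
    have := uP w _ _ p1n p2n dd.
    have -> : \sum_i g m (pk j.+1 q) (X i w) =
        \sum_i g m (pk j q) (X i w) + \sum_i g (pk j q) (pk j.+1 q) (X i w).
      by rewrite -big_split/=; apply: eq_bigr => i _; rewrite gD.
    lra.
have [U [mU iU U0 EU UP]] := step K.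
exists U; split => // w q mq; apply: le_trans (UP w q mq).
have [_ pd] := pkP K q mq.
have -> : \sum_i g m q (X i w) =
    \sum_i g m (pk K q) (X i w) + \sum_i g (pk K q) q (X i w).
  by rewrite -big_split/=; apply: eq_bigr => i _; rewrite gD.
rewrite lerD2l /rem mulr_sumr; apply: ler_sum => i _.
apply: le_trans (ler_norm _) _; apply: le_trans (gH _ _ _) _.
by rewrite ler_wpM2r// ler_wpM2l.
Qed.

End chaining.


(** * Rates from entropy *)

Section rate.
Variable R : realType.

Lemma entropy_rate_gt0 (beta : R) n : (0 < n)%N -> 0 < entropy_rate beta n.
Proof.
move=> n0; have n0' : 0 < (n%:R : R) by rewrite ltr0n.
rewrite /entropy_rate; case: ifP => _; first by rewrite powR_gt0.
case: ifP => _; last by rewrite powR_gt0.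
by rewrite mulr_gt0 ?powR_gt0// ln_gt0// ltr1n.
Qed.

Lemma geometric_sum (rho : R) K : rho != 1 ->
  \sum_(k < K) rho ^+ k.+1 = (rho ^+ K - 1) / (rho - 1) * rho.
Proof.
move=> r1; rewrite subrX1 [(rho - 1) * _]mulrC mulfK ?subr_eq0// mulr_suml.
by apply: eq_bigr => k _; rewrite exprSr.
Qed.

Lemma powR2X (beta : R) k : ((2 : R) ^+ k) `^ beta = (2 `^ beta) ^+ k.
Proof.
by rewrite -powR_mulrn// powRAC powR_mulrn ?powR_ge0.
Qed.

(** With rho = 2^(beta-1) the entropy part is governed by the geometric sum of the
    rho^k, 1 <= k <= K.  It converges for beta < 1, where any K with
    2^K >= sqrt(n) will do; it equals K for beta = 1, where K is about log2 n; and
    it is of the order of its last term for beta > 1, where 2^K of the order of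
    n^(1/(2 beta)) balances it against sqrt(n) / 2^K. *)
Lemma chaining_rate (beta ce : R) : 0 < beta -> 0 < ce ->
  exists2 C : R, 0 < C & forall n, (0 < n)%N -> exists K : nat,
    Num.sqrt n%:R / 2 ^+ K +
      \sum_(k < K) 2 * (1 + ce * (2 ^+ k.+1) `^ beta) / 2 ^+ k.+1
    <= C * (Num.sqrt n%:R * entropy_rate beta n).
Proof.
move=> beta0 ce0; pose rho : R := 2 `^ beta / 2.
have two0 k : 0 < (2 : R) ^+ k by rewrite exprn_gt0.
have rho0 : 0 < rho by rewrite divr_gt0// powR_gt0.
have bound K : \sum_(k < K) 2 * (1 + ce * (2 ^+ k.+1) `^ beta) / 2 ^+ k.+1
    <= 2 + 2 * ce * \sum_(k < K) rho ^+ k.+1.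
  have -> : \sum_(k < K) 2 * (1 + ce * (2 ^+ k.+1) `^ beta) / 2 ^+ k.+1 =
      2 * \sum_(k < K) (2^-1 : R) ^+ k.+1 + 2 * ce * \sum_(k < K) rho ^+ k.+1.
    rewrite !mulr_sumr -big_split/=; apply: eq_bigr => k _.
    rewrite powR2X /rho expr_div_n exprVn; ring.
  rewrite lerD2r geometric_sum; last by lra.
  have t0 : 0 <= (2^-1 : R) ^+ K by rewrite exprn_ge0// invr_ge0.
  have -> : ((2^-1 : R) ^+ K - 1) / (2^-1 - 1) * 2^-1 = 1 - 2^-1 ^+ K by field; lra.
  lra.
have n_ge1 n : (0 < n)%N -> 1 <= n%:R :> R by rewrite ler1n.
have sq1 n : (0 < n)%N -> 1 <= Num.sqrt n%:R :> R.
  by move=> n0; rewrite -[X in X <= _]sqrtr1 ler_sqrt// n_ge1.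
have sqn n : (0 < n)%N -> Num.sqrt n%:R <= n%:R :> R.
  move=> n0; have := sq1 n n0; have : Num.sqrt n%:R ^+ 2 = n%:R :> R by rewrite sqr_sqrtr.
  by nra.
have half n : (0 < n)%N -> Num.sqrt n%:R * n%:R `^ (- 2^-1) = 1 :> R.
  move=> n0; rewrite powRN powR12_sqrt// divff//.
  by rewrite gt_eqF// (lt_le_trans _ (sq1 n n0)).
rewrite /entropy_rate; have [beta1|beta1|beta1] := ltgtP beta 1.
- have rho1 : rho < 1.
    rewrite ltr_pdivrMr// mul1r -[X in _ < X]powRr1//.
    by rewrite /powR !gt_eqF// ltr_expR ltr_pM2r// ln_gt0// ltr1n.
  exists (3 + 2 * ce * (rho / (1 - rho))).
    by rewrite ltr_pwDl// !mulr_ge0 ?invr_ge0//; lra.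
  move=> n n0; exists n; rewrite half// mulr1.
  have h1 : Num.sqrt n%:R / 2 ^+ n <= 1 :> R.
    rewrite ler_pdivrMr// mul1r (le_trans (sqn n n0))// -natrX ler_nat.
    by rewrite ltnW// ltn_expl.
  have h2 : \sum_(k < n) rho ^+ k.+1 <= rho / (1 - rho).
    rewrite geometric_sum ?lt_eqF//.
    have := exprn_ge0 n (ltW rho0); set t := rho ^+ n => t0.
    have -> : (t - 1) / (rho - 1) * rho = (1 - t) * (rho / (1 - rho)).
      by field; lra.
    have : 0 <= rho / (1 - rho) by rewrite divr_ge0; lra.
    nra.
  have := bound n; have : 0 < 2 * ce by lra.
  nra.
- have rho1 : 1 < rho.
    rewrite ltr_pdivlMr// mul1r -[X in X < _]powRr1//.
    by rewrite /powR !gt_eqF// ltr_expR ltr_pM2r// ln_gt0// ltr1n.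
  exists (4 + 4 * ce * (rho / (rho - 1))).
    by rewrite ltr_pwDl// !mulr_ge0 ?invr_ge0//; lra.
  move=> n n0; pose x : R := n%:R `^ (2 * beta)^-1.
  have n0' : 0 < (n%:R : R) by rewrite ltr0n.
  have x1 : 1 <= x.
    rewrite /x -[leLHS](powRr0 n%:R) ler_powR ?n_ge1// invr_ge0; lra.
  have xs : x <= Num.sqrt n%:R.
    rewrite -powR12_sqrt// ler_powR ?n_ge1// lef_pV2 ?posrE; lra.
  have xb : x `^ beta = Num.sqrt n%:R.
    rewrite -powRrM -powR12_sqrt//; congr (_ `^ _); field; lra.
  have [K /andP[lo hi]] := dyadic_floor x1.
  exists K; rewrite powRN -/x.
  set s := Num.sqrt n%:R in xs xb *.
  have s0 : 0 < s by lra.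
  have h1 : s / 2 ^+ K <= 2 * (s / x).
    rewrite ler_pdivrMr// (_ : 2 * (s / x) * _ = s * 2 ^+ K.+1 / x); last first.
      by rewrite exprS; field; lra.
    by rewrite ler_pdivlMr; [rewrite ler_pM2l// ltW|lra].
  have h0 : 1 <= s / x by rewrite ler_pdivlMr ?mul1r//; lra.
  have h2 : \sum_(k < K) rho ^+ k.+1 <= 2 * (s / x) * (rho / (rho - 1)).
    rewrite geometric_sum ?gt_eqF//.
    have rK : rho ^+ K <= s / 2 ^+ K.
      rewrite /rho expr_div_n -powR2X ler_pM2r ?invr_gt0// -xb.
      by apply: ge0_ler_powR; rewrite ?nnegrE//; [exact: ltW|lra].
    have -> : (rho ^+ K - 1) / (rho - 1) * rho = (rho ^+ K - 1) * (rho / (rho - 1)).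
      by rewrite mulrAC mulrA.
    by rewrite ler_wpM2r ?divr_ge0//; lra.
  have := bound K; have : 0 < 2 * ce by lra.
  have : 0 <= rho / (rho - 1) by rewrite divr_ge0; lra.
  set r := rho / (rho - 1) in h2 *; set y := s / x in h0 h1 h2 *.
  nra.
- have ln2 : 0 < ln (2 : R) by rewrite ln_gt0// ltr1n.
  exists ((4 + 2 * ce) / ln 2); first by rewrite divr_gt0//; lra.
  move=> n n0; have [K /andP[lo hi]] := dyadic_floor (n_ge1 n n0).
  exists K; rewrite [X in _ <= _ * X]mulrA half// mul1r.
  have lnn : ln 2 <= ln n.+1%:R :> R by rewrite ler_ln ?posrE ?ltr0n// ler_nat.
  have lnK : K%:R * ln 2 <= ln n.+1%:R :> R.
    rewrite -ln_powR powR_mulrn// ler_ln ?posrE ?ltr0n//.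
    by rewrite (le_trans lo)// ler_nat.
  have h1 : Num.sqrt n%:R / 2 ^+ K <= 2 :> R.
    by rewrite ler_pdivrMr// -exprS (le_trans (sqn n n0))// ltW.
  have h2 : \sum_(k < K) rho ^+ k.+1 = K%:R.
    rewrite /rho beta1 powRr1// divff//.
    by under eq_bigr do rewrite expr1n; rewrite sumr_const card_ord.
  have := bound K; rewrite h2 => h3; rewrite [leRHS]mulrAC ler_pdivlMr//.
  apply: (@le_trans _ _ ((2 + (2 + 2 * ce * K%:R)) * ln 2)).
    by rewrite ler_pM2r//; lra.
  nra.
Qed.

End rate.


(** * Peeling, laws and nets *)

Lemma two_powRN_lt1 (R : realType) (x : R) : 0 < x -> 2 `^ (- x) < 1.
Proof.
move=> x0; have ln2 : 0 < ln (2 : R) by rewrite ln_gt0// ltr1n.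
by rewrite /powR gt_eqF// expR_lt1 pmulr_llt0// oppr_lt0.
Qed.

Section probability_lemmas.
Context (R : realType) (d : measure_display) (T : measurableType d)
        (P : probability T R).
Local Notation L1 f := (P.-integrable [set: T] (EFin \o f)).

Lemma markov_sqr (A : set T) (U : T -> R) (t : R) : measurable A -> 0 < t ->
  measurable_fun setT U ->
  L1 (fun w => U w ^+ 2) -> (forall w, A w -> t <= U w) ->
  (P A <= ((\int[P]_w U w ^+ 2) / t ^+ 2)%:E)%E.
Proof.
move=> mA t0 mU iU AU.
have t20 : 0 < t ^+ 2 by rewrite exprn_gt0.
have iU' := L1Z (t ^+ 2)^-1 iU.
have i1 : L1 (\1_A : T -> R).
  apply: (L1_le _ (L1_cst P 1)); first exact: measurable_indic.
  by move=> w; rewrite indicE; case: (_ \in _); rewrite ?normr1 ?normr0.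
have -> : P A = (\int[P]_w \1_A w)%:E.
  by rewrite /Rintegral integral_indic// setIT fineK ?fin_num_measure.
rewrite lee_fin mulrC -RintegralZl//; apply: le_expect => // w.
rewrite indicE; case: (boolP (w \in A)) => [/set_mem/AU tU|_].
  rewrite -(ler_pM2l t20) mulr1 mulrA divff ?gt_eqF// mul1r.
  by rewrite ler_pXn2r ?nnegrE//; lra.
by rewrite mulr_ge0 ?invr_ge0 ?sqr_ge0.
Qed.

(** On the shell r_j <= Z <= r_(j+1), r_j = 2^j s, the function U for
    delta = r_(j+1) is at least kappa r_j^gamma; by Markov the shell has
    probability at most 4 B r_j^2 / (kappa r_j^gamma)^2, the general term of a
    geometric series of ratio 2^(-2(gamma-1)). *)
Lemma peeling (Z : T -> R) (kappa B gamma s : R) :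
  measurable_fun setT Z -> 0 < kappa -> 0 <= B -> 1 < gamma -> 0 < s ->
  (forall delta, 0 < delta -> exists U : T -> R,
     [/\ measurable_fun setT U, L1 (fun w => U w ^+ 2),
       \int[P]_w U w ^+ 2 <= B * delta ^+ 2 &
       forall w, Z w <= delta -> kappa * Z w `^ gamma <= U w]) ->
  (P [set w | s <= Z w]%R <=
   (4 * B / kappa ^+ 2 / (1 - 2 `^ (- (2 * (gamma - 1))))
      * s `^ (- (2 * (gamma - 1))))%:E)%E.
Proof.
move=> mZ kappa0 B0 gamma1 s0 HU.
set th := - (2 * (gamma - 1)); pose rho : R := 2 `^ th.
have rho0 : 0 < rho by rewrite powR_gt0.
have rho1 : rho < 1.
  by apply: two_powRN_lt1; rewrite mulr_gt0// subr_gt0.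
pose r j : R := 2 ^+ j * s.
have r0 j : 0 < r j by rewrite mulr_gt0// exprn_gt0.
pose F j := [set w | r j <= Z w <= r j.+1].
have mF j : measurable (F j).
  have -> : F j = Z @^-1` `[r j, r j.+1].
    by apply/seteqP; split => w; rewrite /F/= in_itv.
  by rewrite -[X in measurable X]setTI; exact: mZ.
pose c0 := 4 * B / kappa ^+ 2 * s `^ th.
have c00 : 0 <= c0.
  by rewrite mulr_ge0 ?powR_ge0// divr_ge0 ?sqr_ge0// mulr_ge0.
have PF j : (P (F j) <= (c0 * rho ^+ j)%:E)%E.
  have [U [mU iU EU UP]] := HU _ (r0 j.+1).
  have t0 : 0 < kappa * r j `^ gamma by rewrite mulr_gt0// powR_gt0.
  apply: le_trans (markov_sqr (mF j) t0 mU iU _) _ => [w /andP[h1 h2]|].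
    apply: le_trans (UP w h2); rewrite ler_pM2l//.
    by rewrite ge0_ler_powR ?nnegrE//; have := r0 j; lra.
  rewrite lee_fin ler_pdivrMr ?exprn_gt0//; apply: (le_trans EU).
  have rth : r j `^ th * (r j `^ gamma) ^+ 2 = r j ^+ 2.
    rewrite -powR_mulrn ?powR_ge0// -powRrM -powRD.
      by rewrite -powR_mulrn ?ltW//; congr (_ `^ _); rewrite /th; ring.
    by rewrite (gt_eqF (r0 j)) implybT.
  have rthE : r j `^ th = rho ^+ j * s `^ th.
    by rewrite powRM ?powR2X// ?exprn_ge0// ltW.
  have -> : c0 * rho ^+ j * (kappa * r j `^ gamma) ^+ 2 =
      4 * B * (r j `^ th * (r j `^ gamma) ^+ 2).
    by rewrite rthE /c0; field; rewrite gt_eqF.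
  by rewrite rth /r (exprS 2 j) le_eqVlt; apply/orP; left; apply/eqP; ring.
have sub : [set w | s <= Z w] `<=` \bigcup_j F j.
  move=> w /= sZ; have [|k /andP[lo hi]] := @dyadic_floor R (Z w / s).
    by rewrite ler_pdivlMr// mul1r.
  exists k => //; rewrite /F/= /r.
  by rewrite ler_pdivlMr// in lo; rewrite ltr_pdivrMr// in hi; rewrite lo ltW.
have mS : measurable [set w | s <= Z w].
  have -> : [set w | s <= Z w] = Z @^-1` `[s, +oo[.
    by apply/seteqP; split => w; rewrite /= in_itv/= andbT.
  by rewrite -[X in measurable X]setTI; exact: mZ.
have -> : 4 * B / kappa ^+ 2 / (1 - rho) * s `^ th = c0 / (1 - rho).
  by rewrite /c0 mulrAC.
apply: (@le_trans _ _ (\sum_(j <oo) P (F j))%E).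
  exact: measure_sigma_subadditive.
apply: lime_le; first by apply: is_cvg_nneseries.
near=> N.
apply: (@le_trans _ _ (\sum_(0 <= j < N) (c0 * rho ^+ j)%:E)%E).
  exact: lee_sum.
rewrite sumEFin lee_fin -mulr_sumr ler_wpM2l//.
have := subrX1 rho N; rewrite big_mkord; set S := \sum_(i < N) _ => hS.
rewrite -[leRHS]mul1r ler_pdivlMr; last by lra.
have := exprn_ge0 N (ltW rho0); lra.
Unshelve. all: by end_near.
Qed.

Lemma same_law d' (S : measurableType d') (Y Z : {RV P >-> S}) (f : S -> R) :
  (forall A, measurable A -> distribution P Z A = distribution P Y A) ->
  measurable_fun setT f -> L1 (fun w => f (Y w)) ->
  L1 (fun w => f (Z w)) /\ \int[P]_w f (Z w) = \int[P]_w f (Y w).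
Proof.
move=> YZ mf iY; have mf' : measurable_fun setT (EFin \o f) by exact/measurable_EFinP.
have e : (\int[P]_w `|(f (Z w))%:E| = \int[P]_w `|(f (Y w))%:E|)%E.
  transitivity (\int[distribution P Z]_y `|(f y)%:E|)%E.
    by rewrite ge0_integral_pushforward//; apply: measurableT_comp.
  transitivity (\int[distribution P Y]_y `|(f y)%:E|)%E.
    by apply: eq_measure_integral => A mA _; exact: YZ.
  by rewrite ge0_integral_pushforward//; exact: measurableT_comp.
have iZ : L1 (fun w => f (Z w)).
  have mZ : measurable_fun setT Z by exact: measurable_funP.
  apply/integrableP; split; first by apply/measurable_EFinP; exact: (measurableT_comp mf mZ).
  by rewrite e; case/integrableP : iY.
split => //; congr fine.
transitivity (\int[distribution P Z]_y (f y)%:E)%E.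
  by rewrite integral_pushforward.
transitivity (\int[distribution P Y]_y (f y)%:E)%E.
  by apply: eq_measure_integral => A mA _; exact: YZ.
by rewrite integral_pushforward.
Qed.

End probability_lemmas.

Lemma measurable_mdist (R : realType) (Q : completeMetricType R) (q : Q) :
  measurable_fun [set: borel Q] (fun y : borel Q => mdist (y : Q) q).
Proof.
apply: (measurability _ (RGenInftyO.measurableE R)) => //.
move=> _ [_ [x ->] <-]; rewrite setTI; apply: sub_gen_smallest.
rewrite openE => y /=; rewrite in_itv/= => yx.
apply/nbhs_ballP; exists (x - mdist (y : Q) q); first by rewrite /= subr_gt0.
move=> z; rewrite ballEmdist/= in_itv/= => yz.
have := metric_triangle (z : Q) y q; rewrite (metric_sym z y); lra.
Qed.

(** The covering number is at most exp(B^2); being an infimum, it is approached by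
    a cover with fewer than exp(1 + B^2) balls, hence the constant 1. *)
Lemma net_exists (R : realType) (Q : completeMetricType R) (A : set Q) (r B : R) :
  0 <= B -> A !=set0 ->
  (poweR (lne (covering_number A r)) 2^-1 <= B%:E)%E ->
  exists2 s : seq Q, forall q, A q -> exists2 p, p \in s & mdist p q <= r
    & ln (size s)%:R <= 1 + B ^+ 2.
Proof.
move=> B0 [q0 Aq0] hB.
have one_le : (1 <= covering_number A r)%E.
  apply: le_ereal_inf_tmp => _ [s sA <-]; rewrite lee_fin ler1n.
  by case: s sA => // /(_ q0 Aq0) [].
have : (covering_number A r < (expR (1 + B ^+ 2))%:E)%E.
  case: (covering_number A r) one_le hB => [x| |]//.
    rewrite lee_fin => x1; rewrite lne_EFin; last by lra.
    rewrite /= lee_fin lte_fin => h.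
    have lnx : 0 <= ln x by exact: ln_ge0.
    have : ln x <= B ^+ 2.
      rewrite powR12_sqrt// in h; rewrite -(sqr_sqrtr lnx) ler_pXn2r ?nnegrE//.
    move=> h2; rewrite -[x]lnK ?posrE; last by lra.
    by rewrite ltr_expR; lra.
  by move=> _ /=; rewrite invr_eq0 pnatr_eq0.
move=> /ereal_inf_lt[_ [s sA <-]]; rewrite lte_fin => hs.
exists s => [q /sA [p ps]|]; first by exists p.
have s0 : 0 < (size s)%:R :> R.
  by rewrite ltr0n; case: s sA {hs} => // /(_ q0 Aq0) [].
by rewrite -ler_expR lnK ?posrE// ltW.
Qed.


(** * The empirical process of the Frechet functional *)

Section frechet.
Context (R : realType) (Q : completeMetricType R) (d : measure_display)
  (T : measurableType d) (P : probability T R) (Y : {RV P >-> borel Q}) (a : R).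
Local Notation L1 f := (P.-integrable [set: T] (EFin \o f)).
Hypothesis a12 : 2^-1 <= a <= 1.

Definition envelope (o : Q) (y : borel Q) : R := mdist (y : Q) o `^ (2 * a - 1).
Definition cost (q : Q) (y : borel Q) : R := mdist (y : Q) q `^ (2 * a).

Let th01 : 0 <= 2 * a - 1 <= 1.
Proof. by case/andP: a12 => a1 a2; apply/andP; split; lra. Qed.

Let mH o : measurable_fun setT (envelope o).
Proof. exact: (measurableT_comp (measurable_powR _) (measurable_mdist o)). Qed.

Let mD q : measurable_fun setT (cost q).
Proof. exact: (measurableT_comp (measurable_powR _) (measurable_mdist q)). Qed.

Let mY (Z : {RV P >-> borel Q}) : measurable_fun setT Z.
Proof. exact: measurable_funP. Qed.

Let H0 o y : 0 <= envelope o y. Proof. exact: powR_ge0. Qed.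

Let H_triangle o q y : envelope o y <= envelope q y + envelope o q.
Proof.
case/andP: (th01) => th0 th1.
apply: le_trans (powR_subadd th01 (mdist_ge0 _ _) (mdist_ge0 _ _)).
apply: ge0_ler_powR => //; last exact: metric_triangle.
  by rewrite nnegrE mdist_ge0.
by rewrite nnegrE addr_ge0// mdist_ge0.
Qed.

Let HsqrE o y : mdist (y : Q) o `^ (2 * (2 * a - 1)) = envelope o y ^+ 2.
Proof. by rewrite -powR_mulrn// -powRrM mulrC. Qed.

Lemma moment_finite q o : (moment Y a q < +oo)%E -> L1 (fun w => envelope o (Y w) ^+ 2).
Proof.
rewrite /moment unlock => fin.
have iq : L1 (fun w => envelope q (Y w) ^+ 2).
  apply/integrableP; split.
    apply/measurable_EFinP; apply: measurable_funX.
    exact: (measurableT_comp (mH q) (mY Y)).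
  apply: le_lt_trans fin; rewrite le_eqVlt; apply/orP; left; apply/eqP.
  by apply: eq_integral => w _ /=; rewrite HsqrE ger0_norm// sqr_ge0.
apply: (L1_le _ (L1D (L1Z 2 iq) (L1_cst P (2 * envelope o q ^+ 2)))).
  by apply: measurable_funX; exact: (measurableT_comp (mH o) (mY Y)).
move=> w /=; rewrite ger0_norm ?sqr_ge0//.
have := H_triangle o q (Y w); have := H0 o (Y w).
have := sqr_ge0 (envelope q (Y w) - envelope o q).
rewrite sqrrB !expr2; nra.
Qed.

Context (hQ : hadamard_space Q) (o m : Q).
Hypothesis iH2 : L1 (fun w => envelope o (Y w) ^+ 2).

Lemma momentE : moment Y a o = (\int[P]_w envelope o (Y w) ^+ 2)%:E.
Proof.
rewrite /moment unlock /Rintegral fineK ?integrable_fin_num//.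
by apply: eq_integral => w _ /=; rewrite HsqrE.
Qed.

Let M : R := \int[P]_w envelope o (Y w) ^+ 2.

Let M0 : 0 <= M. Proof. by apply: Rintegral_ge0 => w _; exact: sqr_ge0. Qed.

Let iH : L1 (fun w => envelope o (Y w)).
Proof. by apply: L1_sqr => //; exact: (measurableT_comp (mH o) (mY Y)). Qed.

(** Subtracting the value at y = o, a constant that centring removes, makes the
    increment a quadruple difference and hence bounded by the envelope. *)
Definition increment (p q : Q) (y : borel Q) : R :=
  cost q y - cost p y - cost q o + cost p o.

Let mphi p q : measurable_fun setT (increment p q).
Proof.
by apply: measurable_funD => //; apply: measurable_funB => //; exact: measurable_funB.
Qed.

Let phi_le p q y : `|increment p q y| <= 14 * mdist p q * envelope o y.
Proof. by rewrite (metric_sym p q); exact: (quadruple_pow hQ y o q p a12). Qed.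

Let iphi p q : L1 (fun w => increment p q (Y w)).
Proof.
apply: (L1_le _ (L1Z (14 * mdist p q) iH)); last by move=> w; exact: phi_le.
exact: (measurableT_comp (mphi p q) (mY Y)).
Qed.

Definition mean_increment p q : R := \int[P]_w increment p q (Y w).
Let h : R := \int[P]_w envelope o (Y w).
Definition noise p q y : R := mean_increment p q - increment p q y.
Definition noise_envelope y : R := envelope o y + h.

Let h0 : 0 <= h. Proof. by apply: Rintegral_ge0 => w _; exact: H0. Qed.

Let e_le p q : `|mean_increment p q| <= 14 * mdist p q * h.
Proof.
apply: le_trans (le_normr_Rintegral _ (iphi p q)) _ => //.
rewrite -RintegralZl//; apply: le_expect => [||w]; last exact: phi_le.
  by apply: (integrable_norm (iphi p q)).
exact: L1Z.
Qed.

Let G_le p q y : `|noise p q y| <= 14 * mdist p q * noise_envelope y.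
Proof.
apply: le_trans (ler_normB _ _) _; rewrite /noise_envelope mulrDr addrC.
by apply: lerD; [exact: phi_le|exact: e_le].
Qed.

Let GD p q r y : noise p q y + noise q r y = noise p r y.
Proof.
have -> : noise p q y + noise q r y =
    (mean_increment p q + mean_increment q r) - (increment p q y + increment q r y).
  by rewrite /noise (opprD (increment p q y)) addrACA.
have phiD z : increment p q z + increment q r z = increment p r z by rewrite /increment; ring.
rewrite phiD /noise; congr (_ - _); rewrite /mean_increment -RintegralD//.
by apply: eq_Rintegral => w _; exact: phiD.
Qed.

Let mG p q : measurable_fun setT (noise p q).
Proof. exact: measurable_funB. Qed.

Let mHb : measurable_fun setT noise_envelope.
Proof. exact: measurable_funD. Qed.

Let iHb2 : L1 (fun w => noise_envelope (Y w) ^+ 2).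
Proof.
apply: (L1_le _ (L1D (L1Z 2 iH2) (L1_cst P (2 * h ^+ 2)))).
  by apply: measurable_funX; exact: (measurableT_comp mHb (mY Y)).
move=> w /=; rewrite ger0_norm ?sqr_ge0// /noise_envelope.
have := sqr_ge0 (envelope o (Y w) - h); rewrite sqrrB sqrrD; lra.
Qed.

Let Hb2_le : \int[P]_w noise_envelope (Y w) ^+ 2 <= 4 * M.
Proof.
have hM : h ^+ 2 <= M.
  have iZ := L1Z (- 2 * h) iH.
  have : 0 <= \int[P]_w (envelope o (Y w) ^+ 2 + (- 2 * h * envelope o (Y w) + h ^+ 2)).
    apply: Rintegral_ge0 => w _; have := sqr_ge0 (envelope o (Y w) - h); rewrite sqrrB; lra.
  rewrite RintegralD//; last by apply: (L1D iZ); exact: (L1_cst P).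
  rewrite RintegralD//; last exact: (L1_cst P).
  rewrite RintegralZl// Rintegral_prob_cst -/h -/M; lra.
have : \int[P]_w noise_envelope (Y w) ^+ 2 <=
    \int[P]_w (2 * envelope o (Y w) ^+ 2 + 2 * h ^+ 2).
  apply: le_expect => //; first by apply: L1D; [exact: L1Z|exact: (L1_cst P)].
  move=> w; rewrite /noise_envelope.
  by have := sqr_ge0 (envelope o (Y w) - h); rewrite sqrrB sqrrD; lra.
rewrite RintegralD//; [|exact: L1Z|exact: (L1_cst P)].
rewrite RintegralZl// Rintegral_prob_cst -/M; lra.
Qed.

Let iG p q : L1 (fun w => noise p q (Y w)).
Proof.
apply: (L1_le _ (L1Z (14 * mdist p q) (L1D iH (L1_cst P h)))).
  exact: (measurableT_comp (mG p q) (mY Y)).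
by move=> w; exact: G_le.
Qed.

Let G0 p q : \int[P]_w noise p q (Y w) = 0.
Proof.
rewrite /noise RintegralB//; last exact: (L1_cst P).
by rewrite Rintegral_prob_cst subrr.
Qed.

Lemma objectiveE q : objective Y a m q = (mean_increment m q + (cost q o - cost m o))%:E.
Proof.
rewrite /objective unlock.
transitivity (\int[P]_w (increment m q (Y w) + (cost q o - cost m o))%:E)%E.
  by apply: eq_integral => w _; congr EFin; rewrite /increment /cost; ring.
rewrite -[LHS]fineK ?integrable_fin_num//; last first.
  by apply: L1D => //; exact: (L1_cst P).
congr EFin.
rewrite -/(Rintegral P setT (fun w => increment m q (Y w) + (cost q o - cost m o))).
by rewrite RintegralD ?Rintegral_prob_cst//; exact: (L1_cst P).
Qed.

Context (beta gamma ce cg C : R).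
Hypotheses (beta0 : 0 < beta) (gamma1 : 1 < gamma) (ce0 : 0 < ce) (cg0 : 0 < cg)
  (C0 : 0 < C)
  (rateC : forall n, (0 < n)%N -> exists K : nat,
    Num.sqrt n%:R / 2 ^+ K +
      \sum_(k < K) 2 * (1 + ce * (2 ^+ k.+1) `^ beta) / 2 ^+ k.+1
    <= C * (Num.sqrt n%:R * entropy_rate beta n))
  (growth : forall q, ((cg * mdist m q `^ gamma)%:E <= objective Y a m q)%E)
  (entropy : forall delta r : R, 0 < delta -> 0 < r ->
    (poweR (lne (covering_number (cball m delta) r)) 2^-1
     <= (ce * (delta / r) `^ beta)%:E)%E).

Section sample.
Context (n : nat) (Yn : 'I_n -> {RV P >-> borel Q}) (mn : {RV P >-> borel Q}).
Hypotheses (n0 : (0 < n)%N) (cop : independent_copies Y Yn)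
  (argm : forall w, argmin (empirical_objective a o (fun i => Yn i w)) (mn w)).

(** The left-hand side is at most n F(m_n) by growth, and the sum of the noise is
    n (F - Fn)(m_n), where Fn(m_n) <= Fn(m) = 0. *)
Lemma basic_inequality w :
  n%:R * cg * mdist m (mn w : Q) `^ gamma <= \sum_i noise m (mn w : Q) (Yn i w).
Proof.
set q : Q := mn w.
have n0' : 0 < (n%:R : R) by rewrite ltr0n.
have := growth q; rewrite objectiveE lee_fin => gr.
have := argm w m; rewrite /empirical_objective ler_pM2l ?invr_gt0// => emp.
have -> : \sum_i noise m q (Yn i w) = n%:R * (mean_increment m q + (cost q o - cost m o)) +
    (\sum_(i < n) (mdist (Yn i w : Q) m `^ (2 * a) - mdist (Yn i w : Q) o `^ (2 * a)) -
     \sum_(i < n) (mdist (Yn i w : Q) q `^ (2 * a) - mdist (Yn i w : Q) o `^ (2 * a))).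
  have -> : n%:R * (mean_increment m q + (cost q o - cost m o)) =
      \sum_(i < n) (mean_increment m q + (cost q o - cost m o)).
    by rewrite sumr_const card_ord mulr_natl.
  rewrite -sumrB -big_split/=; apply: eq_bigr => i _; rewrite /noise /increment /cost; ring.
have : 0 <= n%:R * (mean_increment m q + (cost q o - cost m o) - cg * mdist m q `^ gamma).
  by rewrite mulr_ge0 ?subr_ge0// ltW.
move: emp; rewrite -/q; lra.
Qed.

(** Chaining with nets of log-cardinality at most 1 + (ce 2^(k beta))^2.  The net
    of index 0 is the centre m alone, so the chain starts at m. *)
Lemma ball_bound delta : 0 < delta -> exists U : T -> R,
  [/\ measurable_fun setT U, L1 (fun w => U w ^+ 2),
    \int[P]_w U w ^+ 2 <=
      1152 * 14 ^+ 2 * (n%:R * (4 * M)) * (C * (Num.sqrt n%:R * entropy_rate beta n)) ^+ 2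
      * delta ^+ 2 &
    forall w q, mdist m q <= delta -> \sum_i noise m q (Yn i w) <= U w].
Proof.
move=> delta0; have two0 k : 0 < (2 : R) ^+ k by rewrite exprn_gt0.
have dr k : delta / (delta / 2 ^+ k) = 2 ^+ k by field; rewrite !gt_eqF.
have /choice[net0 net0P] k : exists s : seq Q,
    (forall q, mdist m q <= delta -> exists2 p, p \in s & mdist p q <= delta / 2 ^+ k) /\
    ln (size s)%:R <= 1 + (ce * (2 ^+ k) `^ beta) ^+ 2.
  have := entropy delta0 (divr_gt0 delta0 (two0 k)); rewrite dr => hs.
  have [||s s1 s2] := net_exists _ _ hs.
  - by rewrite mulr_ge0 ?powR_ge0// ltW.
  - by exists m; rewrite /cball/= mdistxx ltW.
  - by exists s.
pose net k := if k is 0%N then [:: m] else net0 k.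
pose c k : R := 2 * (1 + ce * (2 ^+ k) `^ beta).
have x0 k : 0 < ce * (2 ^+ k) `^ beta by rewrite mulr_gt0// powR_gt0.
have ent k : 1 + ln (size (net k))%:R + ln (size (net k.+1))%:R <= c k.+1 ^+ 2.
  have xx : ce * (2 ^+ k) `^ beta <= ce * (2 ^+ k.+1) `^ beta.
    rewrite ler_pM2l// ge0_ler_powR ?nnegrE//; first exact: ltW.
    by rewrite ler_eXn2l// ltr1n.
  have l1 : ln (size (net k))%:R <= 1 + (ce * (2 ^+ k) `^ beta) ^+ 2.
    case: k {xx} => [|k] /=; last by case: (net0P k.+1).
    by rewrite ln1 addr_ge0// sqr_ge0.
  have [_ l2] := net0P k.+1; have px := x0 k; have py := x0 k.+1; rewrite /c.
  set x := ce * (2 ^+ k) `^ beta in xx l1 px.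
  set y := ce * (2 ^+ k.+1) `^ beta in xx l2 py *.
  have : x ^+ 2 <= y ^+ 2 by apply: ler_pM => //; exact: ltW.
  rewrite /net -/(net k); nra.
have [K hK] := rateC n0.
have cov k q : mdist m q <= delta ->
    exists2 p, p \in net k & mdist p q <= delta / 2 ^+ k.
  case: k => [|k] hq; last exact: (net0P k.+1).1.
  by exists m; rewrite ?mem_head// expr0 divr1.
have c0 k : 0 < c k by rewrite /c mulr_gt0// addr_gt0.
have Hb0 y : 0 <= noise_envelope y by rewrite addr_ge0.
have iHbn i : L1 (fun w => noise_envelope (Yn i w) ^+ 2).
  exact: (same_law (cop.2 i) (measurable_funX 2 mHb) iHb2).1.
have G0n p q i : \int[P]_w noise p q (Yn i w) = 0.
  by rewrite (same_law (cop.2 i) (mG p q) (iG p q)).2.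
have [U [mU iU U0 EU UP]] := chaining n0 cop.1 mG mHb Hb0 (ler0n R 14) G_le GD iHbn G0n
  K (ltW delta0) erefl cov c0 ent.
exists U; split => //; apply: (le_trans EU).
have Vle : \sum_i \int[P]_w noise_envelope (Yn i w) ^+ 2 <= n%:R * (4 * M).
  apply: (@le_trans _ _ (\sum_(i < n) 4 * M)).
    2: by rewrite sumr_const card_ord -[leLHS]mulr_natl.
  by apply: ler_sum => i _; rewrite (same_law (cop.2 i) (measurable_funX 2 mHb) iHb2).2.
have V0 : 0 <= \sum_i \int[P]_w noise_envelope (Yn i w) ^+ 2.
  by apply: sumr_ge0 => i _; apply: Rintegral_ge0 => w _; exact: sqr_ge0.
set X := _ + _ in EU *; have X0 : 0 <= X.
  apply: addr_ge0; first by rewrite divr_ge0// ltW.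
  by apply: sumr_ge0 => k _; rewrite divr_ge0// ltW.
have X2 : X ^+ 2 <= (C * (Num.sqrt n%:R * entropy_rate beta n)) ^+ 2.
  by rewrite !expr2; apply: ler_pM.
set Z := _ ^+ 2 in X2 *; set k0 := 1152 * 14 ^+ 2.
have k00 : 0 <= k0 by rewrite mulr_ge0 ?ler0n ?sqr_ge0.
rewrite mulrAC ler_wpM2r ?sqr_ge0//; apply: ler_pM => //.
- exact: mulr_ge0.
- exact: sqr_ge0.
- exact: ler_wpM2l.
Qed.

Lemma tail_bound s : 0 < s ->
  (P [set w | (s <= entropy_rate beta n `^ (- (gamma - 1)^-1) * mdist m (mn w : Q))%R]
   <= (4 * (1152 * 14 ^+ 2 * 4 * C ^+ 2) / cg ^+ 2 / (1 - 2 `^ (- (2 * (gamma - 1)))))%:E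
      * moment Y a o * (s `^ (- (2 * (gamma - 1))))%:E)%E.
Proof.
move=> s0; have eta0 := entropy_rate_gt0 beta n0; set eta := entropy_rate beta n in eta0 *.
have n0' : 0 < (n%:R : R) by rewrite ltr0n.
have gam0 : gamma - 1 != 0 by rewrite subr_eq0 gt_eqF.
pose t := s * eta `^ ((gamma - 1)^-1).
have t0 : 0 < t by rewrite mulr_gt0// powR_gt0.
have -> : [set w | s <= eta `^ (- (gamma - 1)^-1) * mdist m (mn w : Q)] =
    [set w | t <= mdist m (mn w : Q)].
  apply/seteqP; split => w /=; rewrite powRN mulrC ler_pdivlMr ?powR_gt0//.
have mZ : measurable_fun setT (fun w => mdist m (mn w : Q)).
  under eq_fun do rewrite metric_sym.
  exact: (measurableT_comp (measurable_mdist m) (mY mn)).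
set k0 := 1152 * 14 ^+ 2; set th := - (2 * (gamma - 1)).
have k00 : 0 <= k0 by rewrite mulr_ge0 ?ler0n ?sqr_ge0.
pose B := k0 * (n%:R * (4 * M)) * (C * (Num.sqrt n%:R * eta)) ^+ 2.
have B0 : 0 <= B.
  by rewrite mulr_ge0 ?sqr_ge0// mulr_ge0// mulr_ge0 ?ler0n// mulr_ge0.
have ncg0 : 0 < n%:R * cg by rewrite mulr_gt0.
apply: le_trans (peeling mZ ncg0 B0 gamma1 t0 _) _ => [delta delta0|].
  have [U [mU iU EU UP]] := ball_bound delta0.
  exists U; split => // w dw; apply: le_trans (basic_inequality w) _.
  exact: UP.
rewrite momentE -!EFinM lee_fin -/th -/M.
have teta : t `^ th = s `^ th / eta ^+ 2.
  rewrite /t powRM ?powR_ge0//; last exact: ltW.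
  congr (_ * _); rewrite -powRrM -powR_invn ?ltW//; congr (_ `^ _).
  by rewrite /th; field.
have sqn : Num.sqrt n%:R ^+ 2 = n%:R :> R by rewrite sqr_sqrtr.
have rho1 : 0 < 1 - 2 `^ th.
  by rewrite subr_gt0; apply: two_powRN_lt1; rewrite mulr_gt0// subr_gt0.
rewrite teta le_eqVlt; apply/orP; left; apply/eqP.
rewrite /B !exprMn sqn; field.
by rewrite !gt_eqF.
Qed.

End sample.
End frechet.


(** * The convergence rate *)

Lemma independent_copies_initial (R : realType) (d d' : measure_display)
  (T : measurableType d) (P : probability T R) (S : measurableType d')
  (Y : {RV P >-> S}) (Ys : nat -> {RV P >-> S}) (n : nat) :
  independent_copies Y Ys -> independent_copies Y (fun i : 'I_n => Ys i).
Proof.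
move=> [ind law]; split => [J A mA|i A mA]; last exact: law.
pose A' k : set S := if insub k is Some i then A i else setT.
have A'E (i : 'I_n) : A' i = A i by rewrite /A' valK.
have mA' k : measurable (A' k) by rewrite /A'; case: insub.
have := ind [fset nat_of_ord i | i in J]%fset A' mA'.
rewrite big_imfset/=; last by move=> i j _ _; exact: val_inj.
have -> : \bigcap_(k in [set` [fset nat_of_ord i | i in J]%fset]) (Ys k @^-1` A' k) =
    \bigcap_(i in [set` J]) (Ys i @^-1` A i).
  apply/seteqP; split => w h i /= iJ.
    by have := h (i : nat); rewrite /= A'E; apply; apply/imfsetP; exists i.
  have /imfsetP[j /= jJ ij] := iJ; rewrite ij A'E; exact: h.
by move=> ->; apply: eq_bigr => i _; rewrite A'E.
Qed.

Theorem corollary5 (R : realType) (beta gamma ce cg : R)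
    (hbeta : 0 < beta) (hgamma : 1 < gamma) (hce : 0 < ce) (hcg : 0 < cg) :
  exists c : R, 0 < c /\
  forall (Q : completeMetricType R) (d : measure_display)
    (T : measurableType d) (P : probability T R)
    (Y : {RV P >-> borel Q}) (a : R) (o m : Q),
  hadamard_space Q ->
  2^-1 <= a <= 1 ->
  argmin (objective Y a o) m ->
  (forall q : Q, ((cg * mdist m q `^ gamma)%:E <= objective Y a m q)%E) ->
  (exists q : Q, (moment Y a q < +oo)%E) ->
  (forall delta r : R, 0 < delta -> 0 < r ->
    (poweR (lne (covering_number (cball m delta) r)) 2^-1
     <= (ce * (delta / r) `^ beta)%:E)%E) ->
  (forall (n : nat) (Yn : 'I_n -> {RV P >-> borel Q}) (mn : {RV P >-> borel Q}),
    (0 < n)%N ->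
    independent_copies Y Yn ->
    (forall w : T, argmin (empirical_objective a o (fun i => Yn i w)) (mn w)) ->
    forall s : R, 0 < s ->
      (P [set w | (s <= entropy_rate beta n `^ (- (gamma - 1)^-1)
                        * mdist m (mn w : Q))%R]
       <= c%:E * moment Y a o * (s `^ (- (2 * (gamma - 1))))%:E)%E) /\
  (forall (Ys : nat -> {RV P >-> borel Q}) (ms : nat -> {RV P >-> borel Q}),
    independent_copies Y Ys ->
    (forall n : nat, (0 < n)%N -> forall w : T,
      argmin (empirical_objective a o (fun i : 'I_n => Ys i w)) (ms n w)) ->
    bigO_in_probability P (fun n w => mdist m (ms n w : Q))
      (fun n => entropy_rate beta n `^ (gamma - 1)^-1)).
Proof.
have [C C0 rateC] := chaining_rate hbeta hce.
pose c : R := 4 * (1152 * 14 ^+ 2 * 4 * C ^+ 2) / cg ^+ 2 /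
  (1 - 2 `^ (- (2 * (gamma - 1)))).
have gam0 : 0 < 2 * (gamma - 1) by rewrite mulr_gt0// subr_gt0.
have c0 : 0 < c.
  apply: divr_gt0; last by rewrite subr_gt0; exact: two_powRN_lt1.
  apply: divr_gt0; last by rewrite exprn_gt0.
  have pos k : 0 < (k.+1%:R : R) by rewrite ltr0n.
  apply: mulr_gt0 (pos 3) _; apply: mulr_gt0 _ (exprn_gt0 2 C0).
  by apply: mulr_gt0 _ (pos 3); apply: mulr_gt0 (pos 1151) (exprn_gt0 2 (pos 13)).
exists c; split => // Q d T P Y a o m hQ a12 _ growth [q qfin] entropy.
have iH2 := moment_finite a12 o qfin.
have tail n Yn mn n0 cop argm s s0 := tail_bound a12 hQ iH2 hbeta hgamma hce hcg
  rateC growth entropy (n := n) (Yn := Yn) (mn := mn) n0 cop argm (s := s) s0.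
split => [n Yn mn n0 cop argm s s0|Ys ms cop argm e e0].
  exact: (tail n Yn mn n0 cop argm s s0).
have [M M0 ME] : exists2 M : R, 0 <= M & moment Y a o = M%:E.
  exists (\int[P]_w envelope a o (Y w) ^+ 2); last exact: momentE.
  by apply: Rintegral_ge0 => w _; exact: sqr_ge0.
(* s below solves (c M + 1) s^(-2(gamma-1)) = e; the 1 covers M = 0. *)
pose t := (c * M + 1) / e.
have cM : 0 <= c * M by rewrite mulr_ge0// ltW.
have t0 : 0 < t by rewrite divr_gt0//; lra.
pose s := t `^ (2 * (gamma - 1))^-1.
have s0 : 0 < s by rewrite powR_gt0.
exists s; split => //; exists 1%N => // n /= n0.
have eta0 := entropy_rate_gt0 beta n0.
have := tail n (fun i : 'I_n => Ys i) (ms n) n0 (independent_copies_initial n cop)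
  (argm n n0) s s0.
have mZ : measurable_fun setT (fun w => mdist m (ms n w : Q)).
  under eq_fun do rewrite metric_sym.
  apply: (measurableT_comp (measurable_mdist m)); exact: measurable_funP.
set r := entropy_rate beta n `^ (gamma - 1)^-1.
have r0 : 0 < r by rewrite powR_gt0.
have -> : [set w | s <= entropy_rate beta n `^ (- (gamma - 1)^-1) * mdist m (ms n w : Q)] =
    [set w | s * r <= mdist m (ms n w : Q)].
  by apply/seteqP; split => w /=; rewrite powRN -/r [_^-1 * _]mulrC ler_pdivlMr.
rewrite -/c => hs; apply: le_trans (le_trans hs _).
  apply: le_measure; rewrite ?inE.
  - have -> : [set w | s * r < `|mdist m (ms n w : Q)|] =
        (fun w => mdist m (ms n w : Q)) @^-1` `]s * r, +oo[.
      by apply/seteqP; split => w; rewrite /= in_itv/= andbT ger0_norm// mdist_ge0.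
    by rewrite -[X in measurable X]setTI; exact: mZ.
  - have -> : [set w | s * r <= mdist m (ms n w : Q)] =
        (fun w => mdist m (ms n w : Q)) @^-1` `[s * r, +oo[.
      by apply/seteqP; split => w; rewrite /= in_itv/= andbT.
    by rewrite -[X in measurable X]setTI; exact: mZ.
  - by move=> w /=; rewrite ger0_norm ?mdist_ge0// => /ltW.
rewrite ME -!EFinM lee_fin /s -powRrM mulrN mulVf ?gt_eqF// powRN powRr1; last exact: ltW.
rewrite /t invf_div mulrA ler_pdivrMr; last by lra.
by nra.
Qed.
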